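(* Suppose Assumption 1 (path realization) and Assumption 2 (additivity along the core, $\mathcal H_\kappa=\mathcal A(\gamma)$) hold. In the Gaussian-shift experiment described in the context, with target $\tau(h)=\langle\tilde\psi_\kappa,h_\kappa\rangle+\gamma(h_\perp)$, for nonempty $B\subseteq\mathcal H_\kappa^\perp\cap\mathcal T$ define $$\mathcal M(B):=\inf_T\sup_{h\in\mathcal H_\kappa\times B}\mathbb E_h(T-\tau(h))^2,\qquad \mathcal M_\perp(B):=\inf_{T_\perp}\sup_{h_\perp\in B}\mathbb E_{h_\perp}(T_\perp-\gamma(h_\perp))^2,$$ where the infima are over randomized statistics of $Z$ and of $Z_\perp$, respectively. Then $$\mathcal M(B)=V_\kappa+\mathcal M_\perp(B).$$ In particular, $\mathcal M(\{0\})=V_\kappa$.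
   Context: Model. $P$ is a fixed element of a set $\mathcal P$ of probability measures; $L_2^0(P)$ is the mean-zero subspace of $L_2(P)$ with inner product $\langle\cdot,\cdot\rangle$. A DQM path with score $h$ is a map $t\mapsto P_t\in\mathcal P$, $t\in[0,\varepsilon)$, $P_0=P$, with $\int[(dP_t^{1/2}-dP^{1/2})/t-\tfrac12h\,dP^{1/2}]^2\to0$ as $t\downarrow0$. The tangent space $\mathcal T\subseteq L_2^0(P)$ is a linear subspace. Assumption 1: $\mathcal T$ is closed in $L_2(P)$ and every $h\in\mathcal T$ is the score of some DQM path in $\mathcal P$. $\gamma:\mathcal T\to\mathbb R$ is the positively homogeneous directional derivative of $\Psi:\mathcal P\to\mathbb R$ at $P$: $t^{-1}\{\Psi(P_t)-\Psi(P)\}\to\gamma(h)$ as $t\downarrow0$ for every $h\in\mathcal T$ and every DQM path with score $h$; $\gamma$ is then continuous. $N(\gamma):=\{h\in\mathcal T:\gamma(h)+\gamma(-h)=0\}$. Core: $\mathcal H_\kappa:=\{w\in N(\gamma):\gamma(v+cw)=\gamma(v)+c\gamma(w)\ \forall v\in N(\gamma),c\in\mathbb R\}$, a closed linear subspace on which $\gamma$ is linear. Additivity space: $\mathcal A(\gamma):=\{w\in\mathcal T:\gamma(h+w)=\gamma(h)+\gamma(w)\ \forall h\in\mathcal T\}$. Assumption 2: $\mathcal H_\kappa=\mathcal A(\gamma)$. $\tilde\psi_\kappa\in\mathcal H_\kappa$ is the Riesz representer of $\gamma|_{\mathcal H_\kappa}$ and $V_\kappa:=\|\tilde\psi_\kappa\|^2$.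 Write $h=h_\kappa+h_\perp$ with $h_\kappa\in\mathcal H_\kappa$, $h_\perp\in\mathcal H_\kappa^\perp\cap\mathcal T$; $h\in\mathcal H_\kappa\times B$ means $h_\kappa\in\mathcal H_\kappa$, $h_\perp\in B$. Experiment. $\Delta$ is the isonormal process on $\mathcal T$ (centred Gaussian, $\operatorname{Cov}(\Delta(g),\Delta(g'))=\langle g,g'\rangle$). Under $h\in\mathcal T$ one observes $Z=\Delta+\langle h,\cdot\rangle$ (a process indexed by $\mathcal T$); $Z=(Z_\kappa,Z_\perp)$ are its restrictions to $\mathcal H_\kappa$ and $\mathcal H_\kappa^\perp\cap\mathcal T$, independent Gaussian shifts indexed by $h_\kappa$ and $h_\perp$. Randomized statistics are real-valued measurable functions of the observation and independent auxiliary randomization. *)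

(* Defs.v *)
From HB Require Import structures.
From mathcomp Require Import all_boot all_order all_algebra.
From mathcomp Require Import all_classical all_reals all_analysis.
Import Order.TTheory GRing.Theory Num.Theory.
Import numFieldNormedType.Exports.

Set Implicit Arguments.
Unset Strict Implicit.
Unset Printing Implicit Defensive.

Local Open Scope classical_set_scope.
Local Open Scope ring_scope.

(* Elements of L_2(P) are square-integrable functions, which carry the module
   structure (the library's quotient [LspaceType] has none). No generality is
   lost: an [L2_closed] set is saturated for P-a.e. equality, scores and inner
   products only depend on P-a.e. classes, hence so does a directional
   derivative, and an isonormal process takes a.s. equal values at a.e. equal
   functions. *)
Notation L2 P := (LfunType P (lee1n 2)).

Section L2.
Context d (X : measurableType d) (R : realType) (P : probability X R).
Implicit Types (f g h : L2 P) (S : set (L2 P)).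

Definition ip f g : R := (\int[P]_x (f x * g x))%R.

Definition L2norm f : R := fine ('N[P]_2%:R%:E[EFin \o f])%E.

Definition linear_subspace S :=
  S 0 /\ forall (a : R) f g, S f -> S g -> S (a *: f + g).

Definition mean_zero S := forall f, S f -> 'E_P[f]%E = 0%E.

Definition L2_closed S :=
  forall f, (forall e : R, 0 < e -> exists2 g, S g & L2norm (f - g) < e) -> S f.

(* $S^\perp \cap T$ *)
Definition orth_in (T S : set (L2 P)) : set (L2 P) :=
  [set h | T h /\ forall w, S w -> ip h w = 0].

End L2.

Section differentiability.
Context d (X : measurableType d) (R : realType).
Implicit Types (P Q : probability X R) (model : set (probability X R)).

Definition is_density (mu : {measure set X -> \bar R}) Q (q : X -> R) :=
  [/\ measurable_fun setT q, forall x, 0 <= q x &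
      forall A, measurable A -> Q A = (\int[mu]_(x in A) (q x)%:E)%E].

(* For each t, [q t] and [p t] are densities of $P_t$ and $P$ with respect to a
   common dominating measure [mu t]; the integral does not depend on the choice
   of [mu t]. Only the values of [Pt] on [0, eps[ matter. *)
Definition DQM_path model P (Pt : R -> probability X R) (h : X -> R) :=
  exists2 eps : R, 0 < eps &
  [/\ forall t, 0 <= t < eps -> model (Pt t),
      Pt 0 = P &
      exists (mu : R -> {sigma_finite_measure set X -> \bar R})
             (q p : R -> X -> R),
        (forall t, 0 < t < eps ->
           is_density (mu t) (Pt t) (q t) /\ is_density (mu t) P (p t)) /\
        (\int[mu t]_x (((Num.sqrt (q t x) - Num.sqrt (p t x)) / t
            - 2^-1 * h x * Num.sqrt (p t x)) ^+ 2)%:E)%E @[t --> 0^'+] --> 0%E].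

Definition path_realization model P (T : set (L2 P)) :=
  L2_closed T /\
  forall h, T h -> exists Pt, DQM_path model P Pt h.

Definition directional_derivative model P (T : set (L2 P))
    (Psi : probability X R -> R) (gamma : L2 P -> R) :=
  (forall (c : R) h, 0 <= c -> T h -> gamma (c *: h) = c * gamma h) /\
  (forall h Pt, T h -> DQM_path model P Pt h ->
     t^-1 * (Psi (Pt t) - Psi P) @[t --> 0^'+] --> gamma h).

End differentiability.

Section core.
Context d (X : measurableType d) (R : realType) (P : probability X R).
Variables (T : set (L2 P)) (gamma : L2 P -> R).

Definition Ngamma : set (L2 P) := [set h | T h /\ gamma h + gamma (- h) = 0].

Definition core : set (L2 P) :=
  [set w | Ngamma w /\ forall v (c : R), Ngamma v ->
     gamma (v + c *: w) = gamma v + c * gamma w].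

Definition additivity_space : set (L2 P) :=
  [set w | T w /\ forall h, T h -> gamma (h + w) = gamma h + gamma w].

Definition riesz_representer (S : set (L2 P)) (psi : L2 P) :=
  S psi /\ forall w, S w -> gamma w = ip psi w.

End core.

Section experiment.
Context d (X : measurableType d) (R : realType) (P : probability X R).
Context d' (Omega : measurableType d') (W : probability Omega R).
Implicit Types (S : set (L2 P)) (Delta : L2 P -> {RV W >-> R}).

(* [normal_prob m 0] is not the Dirac mass at [m], hence the case distinction. *)
Definition is_gaussian (Y : Omega -> R) :=
  exists m s : R, forall A : set R, measurable A ->
    W (Y @^-1` A) = if s == 0 then \d_m A else normal_prob m s A.

(* Only the values of [Delta] on [S] matter. *)
Definition isonormal S Delta :=
  [/\ forall n (c : 'I_n -> R) (g : 'I_n -> L2 P), (forall i, S (g i)) ->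
        is_gaussian (fun w => \sum_(i < n) c i * Delta (g i) w),
      forall g, S g -> 'E_W[Delta g]%E = 0%E &
      forall g g', S g -> S g' ->
        covariance W (Delta g) (Delta g') = (ip g g')%:E].

Definition cylinders S : set (set (S -> R)) :=
  [set A | exists (g : S) (B : set R),
     measurable B /\ A = [set z | B (z g)]].

(* sample space of a process indexed by S, with its product sigma-algebra *)
Definition sample_space S := g_sigma_algebraType (@cylinders S).

(* restriction to S of the observation $Z = \Delta + \langle h, \cdot\rangle$ *)
Definition obs S Delta (h : L2 P) (w : Omega) : sample_space S :=
  fun g => Delta (\val g) w + ip h (\val g).

Definition risk S Delta d'' (U : measurableType d'') (Q : probability U R)
    (f : sample_space S * U -> R) (h : L2 P) (a : R) : \bar R :=
  'E_(W \x Q)[fun wu => ((f (obs Delta h wu.1, wu.2) - a) ^+ 2)%R]%E.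

(* Parameters range over [Theta]; under [j] one observes the process shifted by
   [shift j] and estimates [tau j]. A randomized statistic is a measurable
   function of the observation and of an independent auxiliary variable with an
   arbitrary law [Q]. *)
Definition minimax S Delta (J : Type) (Theta : set J) (shift : J -> L2 P)
    (tau : J -> R) : \bar R :=
  ereal_inf [set r | exists d'' (U : measurableType d'') (Q : probability U R)
                            (f : sample_space S * U -> R),
    measurable_fun setT f /\
    r = ereal_sup [set risk Delta Q f (shift j) (tau j) | j in Theta]].

Variables (T : set (L2 P)) (gamma : L2 P -> R) (psi : L2 P).

(* h = h_kappa + h_perp is represented by the pair (h_kappa, h_perp). *)
Definition minimax_full Delta (B : set (L2 P)) : \bar R :=
  minimax T Delta (core T gamma `*` B)
    (fun h => h.1 + h.2) (fun h => ip psi h.1 + gamma h.2).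

Definition minimax_perp Delta (B : set (L2 P)) : \bar R :=
  minimax (orth_in T (core T gamma)) Delta B id gamma.

End experiment.

(* Main.v *)
Require Import Defs.
From HB Require Import structures.
From mathcomp Require Import all_boot all_order all_algebra.
From mathcomp Require Import all_classical all_reals all_analysis.
From mathcomp Require Import measurable_realfun ring lra.
Import Order.TTheory GRing.Theory Num.Theory.
Import numFieldNormedType.Exports.

(* Let [V] be the squared norm of [psi] and [S] the orthogonal complement of
   the core in [T].
   Upper bound: add the observation at [psi] to a statistic of the restriction
   of the observation to [S]; its error is [Delta psi], which is centred with
   variance [V] and independent of that restriction.
   Lower bound: let the core parameter be [t psi] with [t] Gaussian of variance
   [b^2 V]. Conditionally on the observation, the core part [t V] of the target
   is Gaussian with mean [rho] times the observation at [psi] and variance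
   [rho V], where [rho = (b V)^2 / (1 + (b V)^2)]. Hence the average risk of a
   statistic is [rho V] plus the risk of a randomized statistic on [S], obtained
   by regenerating the observation off [S] from independent randomness; then let
   [b] tend to infinity.
   Each step replaces a Gaussian process by another one with the same
   covariance. That the covariance determines the law on the product
   sigma-algebra follows from the stability of Gaussian laws under convolution
   and from the fact that the products of half-line indicators are iterated
   bounded limits of trigonometric polynomials. *)

Set Implicit Arguments.
Unset Strict Implicit.
Unset Printing Implicit Defensive.

Local Open Scope classical_set_scope.
Local Open Scope ring_scope.

(** * Gaussian laws *)

Section image_measure.
Context d d' (T1 : measurableType d) (T2 : measurableType d') (R : realType).
Variables (m : {measure set T1 -> \bar R}) (f : T1 -> T2).
Hypothesis mf : measurable_fun setT f.

Definition image_measure : {measure set T2 -> \bar R}.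
Proof. by apply: (Measure.clone _ _ _ (pushforward m f) _). Defined.

Lemma ge0_integral_image (g : T2 -> \bar R) : measurable_fun setT g ->
  (forall y, (0 <= g y)%E) ->
  (\int[image_measure]_y g y = \int[m]_x g (f x))%E.
Proof. by move=> mg g0; rewrite ge0_integral_pushforward// preimage_setT. Qed.

End image_measure.

(** * Affine change of variables for Lebesgue measure *)

Section lebesgue_affine.
Context {R : realType}.
Local Notation mu := (@lebesgue_measure R).

Lemma measurable_affine (m a : R) :
  measurable_fun setT (fun x : R => m + a * x : measurableTypeR R).
Proof. by apply: measurable_funD => //; exact: measurable_funM. Qed.

(** Lebesgue measure is determined by its values on half-open intervals, where the right-hand side
    is computed directly. A negative [a] swaps the endpoints and the closed side, hence the case
    distinction on the sign. *)
Lemma lebesgue_affine (m a : R) (A : set R) : a != 0 -> measurable A ->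
  (mu A = `|a|%:E * mu ((fun x => m + a * x)%R @^-1` A))%E.
Proof.
move=> a0 mA.
pose nu : {measure set (measurableTypeR R) -> \bar R} :=
  mscale (NngNum (normr_ge0 a)) (image_measure mu (measurable_affine m a)).
suff: mu A = nu A by [].
have : forall X, ocitv X -> mu X = nu X; last first.
  by move=> H; have := @lebesgue_measure_unique R nu H A mA.
move=> _ [[x y] _ <-].
rewrite /nu/= /mscale/=.
have -> : image_measure mu (measurable_affine m a) `]x, y]%classic =
    mu (if 0 < a then `](x - m) / a, (y - m) / a]%classic
        else `[(y - m) / a, (x - m) / a[%classic).
  rewrite /=; congr (mu _); case: ltrgtP a0 => // sa _;
    apply/seteqP; split => z /=; rewrite !in_itv/=;
    rewrite ?(ltr_pdivrMr, ler_pdivlMr, ltr_ndivlMr, ler_ndivrMr)//;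
    by rewrite ltrBlDl lerBrDl mulrC// andbC.
case: ltrgtP a0 => // sa _; rewrite !lebesgue_measure_itv/= !lte_fin.
- rewrite ltr_pM2r ?invr_gt0// ltrD2r gtr0_norm//.
  case: ifPn => _; last by rewrite mule0.
  by rewrite -EFinB -EFinM; congr EFin; field; rewrite gt_eqF.
- rewrite ltr_nM2r ?invr_lt0// ltrD2r ltr0_norm//.
  case: ifPn => _; last by rewrite mule0.
  by rewrite -EFinB -EFinM; congr EFin; field; rewrite lt_eqF.
Qed.

Lemma ge0_integral_affine (m a : R) (f : R -> \bar R) : a != 0 ->
  measurable_fun setT f -> (forall x, (0 <= f x)%E) ->
  (\int[mu]_x f x = `|a|%:E * \int[mu]_x f (m + a * x)%R)%E.
Proof.
move=> a0 mf f0.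
pose nu := mscale (NngNum (normr_ge0 a)) (image_measure mu (measurable_affine m a)).
transitivity (\int[nu]_x f x)%E.
  by apply: eq_measure_integral => A mA _; exact: lebesgue_affine.
by rewrite ge0_integral_mscale// ge0_integral_image.
Qed.

End lebesgue_affine.

(** * Affine images and convolutions of normal laws *)

Section normal.
Context {R : realType}.
Local Notation mu := (@lebesgue_measure R).
Local Notation gauss := (@normal_prob R 0 1).
Implicit Types (m s a b x z : R) (A : set R).

Lemma normal_peakM s : normal_peak s = `|s|^-1 * normal_peak 1 :> R.
Proof.
rewrite /normal_peak -mulrnAr sqrtrM ?sqr_ge0// sqrtr_sqr invfM; congr (_ * _).
by rewrite expr1n -mulrnAr mul1r.
Qed.

Lemma normal_pdf_affine m s x : s != 0 ->
  normal_pdf m s (m + s * x) = `|s|^-1 * normal_pdf 0 1 x.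
Proof.
move=> s0; rewrite !normal_pdfE ?oner_neq0// normal_peakM -mulrA; congr (_ * (_ * _)).
rewrite /normal_fun; congr expR; rewrite addrC addKr exprMn.
have : s ^+ 2 != 0 by rewrite expf_neq0.
by rewrite subr0 expr1n; move: (s ^+ 2) (x ^+ 2) => u v u0; field.
Qed.

(** The Jacobian [|s|] cancels the factor [|s|^-1] of the density. *)
Lemma normal_prob_affine m s A : s != 0 -> measurable A ->
  normal_prob m s A = gauss ((fun x => m + s * x) @^-1` A).
Proof.
move=> s0 mA; rewrite /normal_prob integral_mkcond [RHS]integral_mkcond.
rewrite (@ge0_integral_affine _ m s)//; last first.
- by move=> x; rewrite erestrict_ge0// => y _; rewrite lee_fin normal_pdf_ge0.
- apply/(measurable_restrictT _ _).1 => //.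
  by apply/measurable_funTS/measurable_EFinP; exact: measurable_normal_pdf.
rewrite -ge0_integralZl//.
- apply: eq_integral => x _; rewrite /patch.
  have -> : (x \in (fun y => m + s * y) @^-1` A) = (m + s * x \in A).
    by apply/idP/idP; rewrite !inE.
  case: ifPn => _; last by rewrite mule0.
  by rewrite -EFinM normal_pdf_affine// mulrA divff ?mul1r// normr_eq0.
- apply: (@measurableT_comp _ _ _ _ _ _ ((fun x => (normal_pdf m s x)%:E) \_ A));
    last exact: measurable_affine.
  apply/(measurable_restrictT _ _).1 => //.
  by apply/measurable_funTS/measurable_EFinP; exact: measurable_normal_pdf.
- by move=> x _; rewrite erestrict_ge0// => y _; rewrite lee_fin normal_pdf_ge0.
Qed.

(** The Radon-Nikodym derivative of [gauss] agrees almost everywhere with the density. The bounds on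
    [f] provide the integrability that the change of variables asks for. *)
Lemma integral_gauss (f : R -> \bar R) : measurable_fun setT f ->
  (forall x, (0 <= f x <= 1)%E) ->
  (\int[gauss]_x f x = \int[mu]_x (f x * (normal_pdf 0 1 x)%:E))%E.
Proof.
move=> mf f01.
rewrite -(Radon_Nikodym_change_of_variables (normal_prob_dominates 0 1))//=; last first.
  apply/integrableP; split => //.
  rewrite (@le_lt_trans _ _ (\int[gauss]_x cst 1 x)%E)//.
    apply: ge0_le_integral => //; first exact: measurableT_comp.
    by move=> x _; have /andP[f0 f1] := f01 x; rewrite gee0_abs.
  by rewrite integral_cst// mul1e (le_lt_trans (probability_le1 gauss measurableT))// ltry.
apply: ae_eq_integral => //.
- apply: emeasurable_funM => //; apply: (measurable_int mu).
  by apply: Radon_Nikodym_integrable; exact: normal_prob_dominates.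
- apply: emeasurable_funM => //=; apply/measurableT_comp => //=.
  exact: measurable_normal_pdf.
- apply: ae_eqe_mul2l => /=.
  rewrite Radon_NikodymE//=; first exact: normal_prob_dominates.
  move=> abmu; case: cid => /= h [h1 h2 h3].
  apply: integral_ae_eq => //=.
  + by apply/measurable_EFinP; exact: measurable_normal_pdf.
  + by move=> E _ mE; rewrite -h3.
Qed.

(** Completing the square. Both sides are the joint density of [x] and [z = a x + b y] for
    independent standard normal [x] and [y]: the left side conditions [z] on [x], the right side [x]
    on [z]. *)
Lemma normal_pdf_convolution a b x z : 0 < a -> 0 < b ->
  let r := Num.sqrt (a ^+ 2 + b ^+ 2) in
  normal_pdf 0 1 x * normal_pdf (a * x) b z =
  normal_pdf 0 r z * normal_pdf (a * z / r ^+ 2) (b / r) x.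
Proof.
move=> a0 b0 r.
have ab0 : 0 < a ^+ 2 + b ^+ 2 by rewrite addr_gt0// exprn_gt0.
have r0 : 0 < r by rewrite sqrtr_gt0.
have r2 : r ^+ 2 = a ^+ 2 + b ^+ 2 by rewrite sqr_sqrtr// ltW.
rewrite !normal_pdfE ?oner_neq0 ?gt_eqF ?divr_gt0//.
rewrite [normal_peak b]normal_peakM [normal_peak r]normal_peakM.
rewrite [normal_peak (b / r)]normal_peakM !gtr0_norm ?divr_gt0//.
rewrite /normal_fun.
rewrite mulrACA [RHS]mulrACA -!expRD; congr (_ * expR _).
  by field; rewrite !gt_eqF.
rewrite expr_div_n r2.
by field; rewrite !gt_eqF.
Qed.

(** Once the integrals are exchanged, the conditional density of [x] given [z] integrates to one and
    leaves the marginal density of [z]. *)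
Lemma gauss_convolution a b A : 0 < a -> 0 < b -> measurable A ->
  (\int[gauss]_x gauss ((fun y => a * x + b * y)%R @^-1` A))%E =
  gauss ((fun z => Num.sqrt (a ^+ 2 + b ^+ 2) * z) @^-1` A).
Proof.
move=> a0 b0 mA; set r := Num.sqrt _.
have ab0 : 0 < a ^+ 2 + b ^+ 2 by rewrite addr_gt0// exprn_gt0.
have r0 : 0 < r by rewrite sqrtr_gt0.
have -> : (fun z => r * z) = (fun z => 0 + r * z).
  by apply/funext => z; rewrite add0r.
rewrite -normal_prob_affine ?gt_eqF//.
have mp2 : measurable_fun setT (fun xz : R * R => normal_pdf (a * xz.1) b xz.2).
  rewrite /normal_pdf gt_eqF//; apply: measurable_funM => //.
  rewrite /normal_fun; apply: measurableT_comp => //; apply: measurable_funM => //.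
  apply: measurableT_comp => //; apply: measurable_funX; apply: measurable_funB => //.
  exact: measurable_funM.
pose q := (fun xz : R * R => (normal_pdf (a * xz.1) b xz.2)%:E) \_ (setT `*` A).
have mr : measurable_fun setT q.
  apply/(measurable_restrictT _ _).1; first exact: measurableX.
  exact/measurable_funTS/measurable_EFinP.
have E x : gauss ((fun y => a * x + b * y) @^-1` A) =
    (\int[mu]_z q (x, z))%E.
  rewrite -normal_prob_affine ?gt_eqF// /normal_prob integral_mkcond.
  apply: eq_integral => z _; rewrite /patch.
  by congr (if _ then _ else _); apply/idP/idP; rewrite !inE => //= -[].
have F0 xz : (0 <= q xz)%E.
  by rewrite erestrict_ge0// => y _; rewrite lee_fin normal_pdf_ge0.
under eq_integral do rewrite E.
rewrite integral_gauss; first last.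
- move=> x; rewrite -E measure_ge0/= probability_le1//.
  by rewrite -[X in measurable X]setTI; exact: measurable_affine.
- exact: (measurable_fun_fubini_tonelli_F (m2 := mu) _ mr F0).
under eq_integral => x _.
  rewrite -ge0_integralZr//; last by rewrite lee_fin normal_pdf_ge0.
    over.
  exact: (measurableT_comp mr).
have mG : measurable_fun setT (fun xz : R * R => (q xz * (normal_pdf 0 1 xz.1)%:E)%E).
  apply: emeasurable_funM => //; apply/measurable_EFinP.
  by apply: measurableT_comp => //; exact: measurable_normal_pdf.
etransitivity; first apply: (fubini_tonelli (m1 := mu) (m2 := mu) _ mG).
  by move=> xz; rewrite mule_ge0// lee_fin normal_pdf_ge0.
rewrite /normal_prob [RHS]integral_mkcond; apply: eq_integral => z _.
rewrite /q {2}/patch; case: ifPn => zA; last first.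
  rewrite integral0_eq// => x _; rewrite /patch ifF ?mul0e//.
  by apply/negbTE; apply: contra zA; rewrite !inE => -[].
under eq_integral => x _.
  rewrite /patch ifT; last by rewrite inE; split => //; exact: set_mem.
  rewrite /= -EFinM mulrC normal_pdf_convolution// EFinM.
  over.
rewrite ge0_integralZl//; first by rewrite integral_normal_pdf mule1.
- by apply/measurable_EFinP; exact: measurable_normal_pdf.
- by move=> x _; rewrite lee_fin normal_pdf_ge0.
- by rewrite lee_fin normal_pdf_ge0.
Qed.

End normal.

(** * Gaussian laws as affine images of the standard normal law *)

Section gaussian_law.
Context {R : realType}.
Local Notation gauss := (@normal_prob R 0 1).

(* The image of the standard normal law under [x |-> m + s x]: this includes the
   Dirac case [s = 0], where [normal_prob] would not be the Dirac mass. *)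
Definition gauss_law d (Omega : measurableType d) (W : probability Omega R)
    (Y : Omega -> R) (m s : R) :=
  forall A : set R, measurable A ->
    W (Y @^-1` A) = gauss ((fun x => m + s * x) @^-1` A).

(** The density depends on the scale only through its square. *)
Lemma gauss_law_reflect : gauss_law gauss id 0 (-1).
Proof.
move=> A mA.
have <- : normal_prob 0 (-1) A = gauss ((fun x => 0 + -1 * x) @^-1` A).
  by apply: normal_prob_affine => //; rewrite oppr_eq0 oner_eq0.
rewrite /= /normal_prob; apply: eq_integral => x _.
by rewrite !normal_pdfE ?oppr_eq0 ?oner_eq0// /normal_peak /normal_fun sqrrN.
Qed.

(* Its value [1] is never needed: being nonzero, it lets the variance of a
   centred Gaussian law determine its scale. *)
Definition gauss_moment2 : \bar R := (\int[gauss]_x (x ^+ 2)%:E)%E.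

(** Otherwise [x ^+ 2] would vanish almost surely and [gauss] would be carried by [[set 0]], which
    is Lebesgue-null and so [gauss]-null. *)
Lemma gauss_moment2_neq0 : gauss_moment2 != 0%E.
Proof.
apply/eqP => c0.
have /ae_eq_integral_abs :
    measurable_fun setT (fun x : measurableTypeR R => (x ^+ 2 : R)%:E).
  by apply/measurable_EFinP; exact: measurable_funX.
move=> /(_ gauss measurableT)[+ _].
rewrite (_ : (\int[_]_(x in _) _)%E = 0%E); last first.
  by rewrite -c0; apply: eq_integral => x _; rewrite gee0_abs// lee_fin sqr_ge0.
move=> /(_ erefl)[N [mN N0 subN]].
have mu0 : gauss [set 0] = 0%E.
  apply: null_set_integral => //=; last exact: lebesgue_measure_set1.
  by apply/measurable_funTS/measurable_EFinP; exact: measurable_normal_pdf.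
have : (gauss setT <= gauss (N `|` [set 0%R]))%E.
  apply: le_measure; rewrite ?inE//; first exact: measurableU.
  move=> x _; case: (eqVneq x 0) => [->|x0]; [by right|left].
  apply: subN => /= /(_ I)/eqP; rewrite eqe sqrf_eq0; exact/negP.
rewrite measureU0// N0.
rewrite [X in (X <= _)%E](_ : _ = 1%E) ?lee_fin ?ler10//; exact: probability_setT.
Qed.

Section moments.
Context d (Omega : measurableType d) (W : probability Omega R).
Variables (Y : Omega -> R) (m s : R).
Hypotheses (mY : measurable_fun setT Y) (Ylaw : gauss_law W Y m s).

Lemma ge0_integral_gauss_law (f : R -> \bar R) :
  measurable_fun setT f -> (forall x, (0 <= f x)%E) ->
  (\int[W]_w f (Y w) = \int[gauss]_x f (m + s * x)%R)%E.
Proof.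
move=> mf f0; rewrite -(ge0_integral_image W mY mf f0).
rewrite -(ge0_integral_image gauss
  (measurable_affine m s : measurable_fun setT (_ : R -> R)) mf f0).
by apply: eq_measure_integral => A mA _; exact: Ylaw.
Qed.

Lemma integral_gauss_law (f : R -> \bar R) : measurable_fun setT f ->
  (\int[W]_w f (Y w) = \int[gauss]_x f (m + s * x)%R)%E.
Proof.
move=> mf; rewrite integralE [RHS]integralE.
congr (_ - _)%E.
- under eq_integral do rewrite funeposE; under [RHS]eq_integral do rewrite funeposE.
  apply: (ge0_integral_gauss_law (f := fun x => maxe (f x) 0%E)) => //.
    exact: measurable_maxe.
  by move=> x; rewrite le_max lexx orbT.
- under eq_integral do rewrite funenegE; under [RHS]eq_integral do rewrite funenegE.
  apply: (ge0_integral_gauss_law (f := fun x => maxe (- f x)%E 0%E)) => //.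
    by apply: measurable_maxe => //; exact: measurableT_comp.
  by move=> x; rewrite le_max lexx orbT.
Qed.

Lemma integrable_gauss_law : W.-integrable setT (EFin \o Y) ->
  gauss.-integrable setT (fun x => (m + s * x)%:E).
Proof.
move=> /integrableP[_ iY]; apply/integrableP; split.
  by apply/measurable_EFinP; exact: measurable_affine.
rewrite -(ge0_integral_gauss_law (f := fun y => `|y%:E|%E))//.
exact: measurableT_comp.
Qed.

End moments.

Lemma gauss_lawN d (Omega : measurableType d) (W : probability Omega R)
  (Y : Omega -> R) (m s : R) : gauss_law W Y m s -> gauss_law W Y m (- s).
Proof.
move=> YW A mA; rewrite YW//.
have := gauss_law_reflect (A := (fun x => m + s * x) @^-1` A).
rewrite preimage_id => ->; last first.
  by rewrite -[X in measurable X]setTI; exact: measurable_affine.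
by congr (normal_prob _ _ _); apply/funext => x /=; rewrite add0r mulN1r mulNr mulrN.
Qed.

(** The scales [s] and [- s] give the same law, so adding the two resulting expressions of the mean
    leaves [m *+ 2 = 0]. *)
Lemma gauss_law_center d (Omega : measurableType d) (W : probability Omega R)
    (Y : Omega -> R) (m s : R) :
  W.-integrable setT (EFin \o Y) -> (\int[W]_w (Y w)%:E = 0)%E ->
  gauss_law W Y m s -> m = 0.
Proof.
move=> iY EY0 YW.
have mY : measurable_fun setT Y by apply/measurable_EFinP/(measurable_int W).
have E t : gauss_law W Y m t -> (\int[gauss]_x (m + t * x)%:E = 0)%E.
  by move=> Yt; rewrite -EY0 (integral_gauss_law mY Yt).
have := E _ (gauss_lawN YW); rewrite -[in X in X -> _](adde0 (integral _ _ _)).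
rewrite -[in X in X -> _](E _ YW) -integralD//; last 2 first.
- exact: integrable_gauss_law (gauss_lawN YW) iY.
- exact: integrable_gauss_law YW iY.
rewrite (eq_integral (cst (m *+ 2)%:E)); last first.
  by move=> x _ /=; rewrite -EFinD; congr EFin; ring.
rewrite integral_cst// [X in (_ * X)%E](_ : _ = 1%E); last exact: (probability_setT gauss).
by rewrite mule1 (E _ YW) => -[]; lra.
Qed.

(** [v] is the variance, written as the squared scale times the second moment of the standard normal
    law. The scale is nonnegative so that [v] determines it. *)
Definition centered_gaussian d (Omega : measurableType d)
    (W : probability Omega R) (Y : Omega -> R) (v : R) :=
  measurable_fun setT Y /\
  exists s : R, [/\ 0 <= s, gauss_law W Y 0 s & ((s ^+ 2)%:E * gauss_moment2 = v%:E)%E].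

(** The Dirac case of [is_gaussian] becomes the scale [0], the zero mean forces [m = 0], and a
    negative scale is made nonnegative by reflection. *)
Lemma is_gaussian_centered d (Omega : measurableType d) (W : probability Omega R)
    (Y : Omega -> R) (v : R) : is_gaussian W Y ->
  W.-integrable setT (EFin \o Y) ->
  (\int[W]_w (Y w)%:E = 0)%E -> (\int[W]_w (Y w ^+ 2)%:E = v%:E)%E ->
  centered_gaussian W Y v.
Proof.
move=> [m [s YW]] iY EY0 EY2.
have mY : measurable_fun setT Y by apply/measurable_EFinP/(measurable_int W).
have Yms : gauss_law W Y m s.
  move=> A mA; rewrite YW//; case: eqVneq => [->|s0].
    rewrite diracE; case: (boolP (m \in A)) => mA'.
      rewrite (_ : _ @^-1` _ = setT); first by rewrite (probability_setT gauss).
      by apply/seteqP; split => // x _ /=; rewrite mul0r addr0; exact: set_mem.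
    rewrite (_ : _ @^-1` _ = set0); first by rewrite measure0.
    apply/seteqP; split => // x /=; rewrite mul0r addr0 => Am.
    by move: mA'; rewrite notin_setE.
  exact: normal_prob_affine.
have m0 := gauss_law_center iY EY0 Yms.
have Y0s : gauss_law W Y 0 `|s|.
  move: Yms; rewrite m0 => Yms; have [s0|s0] := lerP 0 s.
    by rewrite ger0_norm.
  by rewrite ltr0_norm//; exact: gauss_lawN.
split=> //; exists `|s|; split => //.
have m2 : measurable_fun setT (fun y : R => (y ^+ 2)%:E).
  by apply/measurable_EFinP; exact: measurable_funX.
rewrite -EY2 (ge0_integral_gauss_law (f := fun y => (y ^+ 2)%:E) mY Y0s)//; last first.
  by move=> x; rewrite lee_fin sqr_ge0.
rewrite /gauss_moment2 -ge0_integralZl//; last first.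
  by move=> x _; rewrite lee_fin sqr_ge0.
by apply: eq_integral => x _; rewrite -EFinM add0r exprMn.
Qed.

Lemma centered_gaussian_law d1 d2 (O1 : measurableType d1) (O2 : measurableType d2)
    (W1 : probability O1 R) (W2 : probability O2 R) Y1 Y2 (v : R) A :
  centered_gaussian W1 Y1 v -> centered_gaussian W2 Y2 v -> measurable A ->
  W1 (Y1 @^-1` A) = W2 (Y2 @^-1` A).
Proof.
move=> [_ [s [s0 Y1s sv]]] [_ [t [t0 Y2t tv]]] mA.
suff st : s = t by rewrite Y1s// Y2t// st.
have := gauss_moment2_neq0; have : (0 <= gauss_moment2)%E.
  by apply: integral_ge0 => x _; rewrite lee_fin sqr_ge0.
move: sv tv; case: gauss_moment2 => [c|/=|]//.
- rewrite -!EFinM => -[sv] [tv] _; rewrite eqe => c0.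
  apply: (pexpIrn (n := 2)) => //; apply: (mulIf c0).
  by rewrite sv tv.
(* If the second moment were infinite, a finite variance would force the scale [0]. *)
- have aux (x : R) : ((x ^+ 2)%:E * +oo = v%:E)%E -> x = 0.
    case: (eqVneq x 0) => // x0.
    by rewrite gt0_muley// lte_fin exprn_even_gt0.
  by move=> /aux -> /aux ->.
Qed.

(** Stability under convolution: independence is built in by placing the two variables on the two
    factors of a product space. *)
Lemma centered_gaussianD d1 d2 (O1 : measurableType d1) (O2 : measurableType d2)
    (W1 : probability O1 R) (W2 : probability O2 R) Y1 Y2 (v1 v2 : R) :
  centered_gaussian W1 Y1 v1 -> centered_gaussian W2 Y2 v2 ->
  centered_gaussian (W1 \x W2)%E (fun w => Y1 w.1 + Y2 w.2) (v1 + v2).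
Proof.
move=> [mY1 [a [a0 Y1a av]]] [mY2 [b [b0 Y2b bv]]].
have mY : measurable_fun setT (fun w : O1 * O2 => Y1 w.1 + Y2 w.2).
  by apply: measurable_funD; exact: measurableT_comp.
split=> //; exists (Num.sqrt (a ^+ 2 + b ^+ 2)); split; first exact: sqrtr_ge0.
- move=> A mA; rewrite /= /product_measure1/=.
  have mb : measurable_fun setT (fun xy : R * R => xy.1 + b * xy.2).
    by apply: measurable_funD => //; exact: measurable_funM.
  pose h (x : R) := gauss ((fun y => x + b * y) @^-1` A).
  have mh : measurable_fun setT h.
    have mB : measurable ((fun xy : R * R => xy.1 + b * xy.2) @^-1` A).
      by rewrite -[X in measurable X]setTI; exact: mb.
    rewrite (_ : h = gauss \o xsection ((fun xy : R * R => xy.1 + b * xy.2) @^-1` A)).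
      exact: (measurable_fun_xsection gauss mB).
    apply/funext => x; rewrite /h /=; congr (normal_prob _ _ _).
    by apply/seteqP; split => y; rewrite /xsection/= inE.
  transitivity (\int[W1]_w h (Y1 w))%E.
    apply: eq_integral => w _ /=; rewrite /h.
    transitivity (W2 (Y2 @^-1` ((fun y => Y1 w + y) @^-1` A))).
      congr (W2 _); apply/seteqP; split => y; rewrite /xsection/= inE//.
    rewrite Y2b; last by rewrite -[X in measurable X]setTI; exact: measurable_funD.
    by congr (normal_prob _ _ _); apply/funext => y /=; rewrite add0r.
  rewrite (ge0_integral_gauss_law mY1 Y1a mh) => [|x]; last exact: measure_ge0.
  rewrite /h; under eq_integral do rewrite add0r.
  rewrite (_ : (fun z => 0 + _ * z) = *%R (Num.sqrt (a ^+ 2 + b ^+ 2))); last first.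
    by apply/funext => z; rewrite add0r.
  (* [gauss_convolution] concerns positive scales; a zero scale turns one of the two variables into
     the constant [0] and is treated directly. *)
  have [a00|a_neq0] := eqVneq a 0.
    rewrite a00 expr0n/= add0r sqrtr_sqr ger0_norm//.
    under eq_integral do rewrite mul0r.
    rewrite integral_cst// [X in (_ * X)%E](_ : _ = 1%E); last exact: (probability_setT gauss).
    by rewrite mule1; congr (normal_prob _ _ _); apply/funext => y /=; rewrite add0r.
  have [b00|b_neq0] := eqVneq b 0.
    rewrite b00 expr0n/= addr0 sqrtr_sqr ger0_norm//.
    have mA' : measurable ( *%R a @^-1` A).
      by rewrite -[X in measurable X]setTI; exact: measurable_funM.
    transitivity (\int[gauss]_x (\1_( *%R a @^-1` A) x)%:E)%E; last first.
      by rewrite integral_indic// setIT.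
    apply: eq_integral => x _; rewrite indicE.
    case: (boolP (x \in _)) => xA.
      rewrite (_ : _ @^-1` _ = setT); first exact: (probability_setT gauss).
      apply/seteqP; split => // y _ /=; rewrite mul0r addr0.
      by move: xA; rewrite inE.
    rewrite (_ : _ @^-1` _ = set0); first by rewrite measure0.
    apply/seteqP; split => // y /=; rewrite mul0r addr0 => Ax.
    by move: xA; rewrite notin_setE.
  by rewrite gauss_convolution// lt_neqAle eq_sym ?a_neq0 ?b_neq0.
- rewrite sqr_sqrtr ?addr_ge0 ?sqr_ge0// EFinD ge0_muleDl ?lee_fin ?sqr_ge0//.
  by rewrite av bv.
Qed.

End gaussian_law.

(** * Laws on the product sigma-algebra *)

Section smoothstep.
Context {R : realType}.
Implicit Types x : R.

(* Iterating [x |-> (3 x - x^3) / 2] on [[-1, 1]] converges pointwise to the sign function. *)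
Definition smoothstep (x : R) := (3 * x - x ^+ 3) / 2.

Lemma smoothstepN x : smoothstep (- x) = - smoothstep x.
Proof. by rewrite /smoothstep; field. Qed.

Lemma smoothstep_ge x : 0 <= x <= 1 -> x <= smoothstep x <= 1.
Proof.
move=> /andP[x0 x1]; rewrite /smoothstep; apply/andP; split; last first.
  have : 0 <= (1 - x) ^+ 2 * (2 + x) by rewrite mulr_ge0 ?sqr_ge0//; lra.
  by rewrite (_ : _ * _ = 2 - (3 * x - x ^+ 3)); [lra|ring].
have : 0 <= x * ((1 - x) * (1 + x)) by rewrite !mulr_ge0//; lra.
by rewrite (_ : _ * _ = x - x ^+ 3); [lra|ring].
Qed.

Lemma iter_smoothstep_ge n x : 0 <= x <= 1 -> x <= iter n smoothstep x <= 1.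
Proof.
move=> /andP[x0 x1]; elim: n => [|n /andP[xn n1]] /=; first by rewrite lexx.
have /andP[a ->] : iter n smoothstep x <= smoothstep (iter n smoothstep x) <= 1.
  by apply: smoothstep_ge; rewrite n1 (le_trans x0).
by rewrite (le_trans xn).
Qed.

Lemma iter_smoothstepN n x : iter n smoothstep (- x) = - iter n smoothstep x.
Proof. by elim: n => //= n ->; rewrite smoothstepN. Qed.

Lemma iter_smoothstep_norm n x : `|x| <= 1 -> `|iter n smoothstep x| <= 1.
Proof.
move=> x1; wlog x0 : x x1 / 0 <= x => [H|].
  have [x0|/ltW x0] := lerP 0 x; first exact: H.
  rewrite -[x]opprK iter_smoothstepN normrN; apply: H; rewrite ?normrN//.
  by rewrite oppr_ge0.
have /(iter_smoothstep_ge n)/andP[xn n1] : 0 <= x <= 1.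
  by rewrite x0 (le_trans (ler_norm _)).
by rewrite ger0_norm// (le_trans x0).
Qed.

(** By oddness one may take [x > 0]. The iterates [y] stay above [x], and [1 - smoothstep y] is
    [1 - y] times [(1 - y) * (2 + y) / 2], which is at most [1 - x / 2]: the distance to [1] decays
    geometrically. *)
Lemma iter_smoothstep_cvg x : `|x| <= 1 -> iter n smoothstep x @[n --> \oo] --> Num.sg x.
Proof.
move=> x1; wlog x0 : x x1 / 0 < x => [H|].
  have [x0|x0|<-] := ltgtP 0 x; first exact: H.
  - rewrite -[x]opprK sgrN; under eq_fun do rewrite iter_smoothstepN.
    by apply: (@cvgN R R^o); apply: H; rewrite ?normrN ?oppr_gt0.
  - rewrite sgr0 (_ : (fun n => _) = cst 0); first exact: cvg_cst.
    by apply/funext => n /=; elim: n => //= n ->; rewrite /smoothstep; field.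
have {}x1 : 0 <= x <= 1 by rewrite ltW//= (le_trans (ler_norm _)).
rewrite gtr0_sg//.
have P n : 0 <= 1 - iter n smoothstep x <= (1 - x / 2) ^+ n.
  elim: n => [|n /andP[n0 IH]]; first by rewrite expr0/=; lra.
  have /andP[a b] := iter_smoothstep_ge n x1.
  have := iter_smoothstep_ge n.+1 x1; move=> /andP[_] /=.
  move: (iter n smoothstep x) n0 IH a b => y n0 IH a b y1.
  rewrite subr_ge0 y1/= exprS.
  have -> : 1 - smoothstep y = (1 - y) * ((1 - y) * (2 + y) / 2) by rewrite /smoothstep; field.
  rewrite mulrC ler_pM//; last by nra.
  by rewrite divr_ge0// mulr_ge0//; lra.
rewrite -[X in _ --> X]subr0.
rewrite (_ : (fun n => _) = (fun n => 1 - (1 - iter n smoothstep x))); last first.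
  by apply/funext => n; ring.
apply: (@cvgB R R^o); first exact: cvg_cst.
apply: (squeeze_cvgr (f := cst 0) (h := fun n => (1 - x / 2) ^+ n)).
- by apply: nearW => n; exact: P.
- exact: cvg_cst.
- by apply: cvg_expr; rewrite ger0_norm; lra.
Qed.

Lemma sgr_sin x : `|x| < pi -> Num.sg (sin x) = Num.sg x.
Proof.
move=> xpi; wlog x0 : x xpi / 0 < x => [H|].
  have [x0|x0|<-] := ltgtP 0 x; first exact: H.
    by rewrite -[x]opprK sinN sgrN (H (- x)) ?sgrN ?normrN ?oppr_gt0.
  by rewrite sin0.
rewrite !gtr0_sg// sin_gt0_pi// x0/=.
by rewrite (le_lt_trans (ler_norm _)).
Qed.

End smoothstep.

(** * Characteristic functions determine laws on a product space *)

Section cylinder_sets.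
Context {R : realType} {I : Type}.

(** For the index type of a set [S] this is [cylinders S] up to conversion. A general index type
    leaves room for an extra coordinate, as in [option S] below. *)
Definition cyl : set (set (I -> R)) :=
  [set A | exists (i : I) (B : set R), measurable B /\ A = [set y | B (y i)]].

Local Notation T := (g_sigma_algebraType cyl).

Lemma measurable_coord i : measurable_fun setT (fun y : T => y i).
Proof.
move=> _ B mB; rewrite setTI; apply: sub_sigma_algebra.
by exists i, B.
Qed.

Lemma measurable_fun_cyl d (O : measurableType d) (phi : O -> T) :
  (forall i, measurable_fun setT (fun w => phi w i)) -> measurable_fun setT phi.
Proof.
move=> mphi; have H := @measurability _ _ O T setT phi cyl erefl.
apply: H => _ [_ [i [B [mB ->]]] <-].
exact: mphi.
Qed.

Implicit Types (F G : T -> R) (l : seq (R * I)).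

Definition lin l (y : T) : R := \sum_(p <- l) p.1 * y p.2.

Lemma measurable_lin l : measurable_fun setT (lin l).
Proof.
apply: measurable_sum => p; apply: measurable_funM => //; exact: measurable_coord.
Qed.

Variables (m1 m2 : {measure set T -> \bar R}).
Hypotheses (m1T : m1 setT = 1%E) (m2T : m2 setT = 1%E).
(** Equality of the characteristic functions of all finite-dimensional marginals: the phases [0] and
    [- pi / 2] give their real and imaginary parts. *)
Hypothesis cos12 : forall l b,
  \int[m1]_y cos (lin l y + b) = \int[m2]_y cos (lin l y + b).

Definition bounded_meas F := measurable_fun setT F /\ exists M, forall y, `|F y| <= M.

Lemma bounded_meas_cos l b : bounded_meas (fun y => cos (lin l y + b)).
Proof.
split; last by exists 1 => y; rewrite ler_norml cos_geN1 cos_le1.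
have mc : measurable_fun setT (@cos R).
  by apply: continuous_measurable_fun; exact: continuous_cos.
apply: (measurableT_comp mc).
by apply: measurable_funD => //; exact: measurable_lin.
Qed.

Lemma bounded_measM F G : bounded_meas F -> bounded_meas G -> bounded_meas (F \* G).
Proof.
move=> [mF [M FM]] [mG [N GN]]; split; first exact: measurable_funM.
by exists (M * N) => y; rewrite normrM ler_pM.
Qed.

Lemma bounded_measD F G : bounded_meas F -> bounded_meas G -> bounded_meas (F \+ G).
Proof.
move=> [mF [M FM]] [mG [N GN]]; split; first exact: measurable_funD.
by exists (M + N) => y; rewrite (le_trans (ler_normD _ _)) ?lerD.
Qed.

Lemma bounded_meas_cst (a : R) : bounded_meas (cst a).
Proof. by split => //; exists `|a|. Qed.

Lemma bounded_meas_integrable (m : {measure set T -> \bar R}) F : m setT = 1%E ->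
  bounded_meas F -> m.-integrable setT (EFin \o F).
Proof.
move=> mT [mF [M FM]]; apply: measurable_bounded_integrable => //.
  by rewrite mT ltry.
exists M; split; first exact: num_real.
by move=> x Mx y _ /=; rewrite (le_trans (FM y))// ltW.
Qed.

(** The signed measures with density [F] with respect to [m1] and [m2] have the same characteristic
    functions. *)
Definition cos_indist F := bounded_meas F /\
  forall l b, \int[m1]_y (F y * cos (lin l y + b)) = \int[m2]_y (F y * cos (lin l y + b)).

Lemma cos_indist1 : cos_indist (cst 1).
Proof.
split; first exact: bounded_meas_cst.
by move=> l b; under eq_Rintegral do rewrite mul1r; under [RHS]eq_Rintegral do rewrite mul1r.
Qed.

Lemma cos_indistD F G : cos_indist F -> cos_indist G -> cos_indist (F \+ G).
Proof.
move=> [bF cF] [bG cG]; split; first exact: bounded_measD.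
move=> l b; have bc := bounded_meas_cos l b.
under eq_Rintegral do rewrite mulrDl; under [RHS]eq_Rintegral do rewrite mulrDl.
rewrite !RintegralD ?cF ?cG//; apply: bounded_meas_integrable => //; exact: bounded_measM.
Qed.

Lemma cos_indistZ (a : R) F : cos_indist F -> cos_indist (fun y => a * F y).
Proof.
move=> [bF cF]; split; first by apply: (@bounded_measM (cst a)) => //; exact: bounded_meas_cst.
move=> l b; have bc := bounded_meas_cos l b.
under eq_Rintegral do rewrite -mulrA; under [RHS]eq_Rintegral do rewrite -mulrA.
rewrite !RintegralZl ?cF//; apply: bounded_meas_integrable => //; exact: bounded_measM.
Qed.

Lemma bounded_meas_lim (F_ : nat -> T -> R) F (M : R) : (forall n, bounded_meas (F_ n)) ->
  (forall n y, `|F_ n y| <= M) ->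
  (forall y, F_ n y @[n --> \oo] --> F y) -> bounded_meas F.
Proof.
move=> bF FM FF; split.
  by apply: (measurable_fun_cvg (h := F_)) => //; move=> n; exact: (bF n).1.
exists M => y; have c : `|F_ n y| @[n --> \oo] --> `|F y|.
  by apply: cvg_norm; exact: FF.
rewrite -(cvg_lim _ c)//; apply: limr_le; first exact: cvgP c.
by apply: nearW => n.
Qed.

Lemma bounded_meas_dct (m : {measure set T -> \bar R}) (F_ : nat -> T -> R) F G (M : R) :
  m setT = 1%E -> (forall n, bounded_meas (F_ n)) -> bounded_meas G ->
  (forall n y, `|F_ n y| <= M) ->
  (forall y, F_ n y @[n --> \oo] --> F y) ->
  \int[m]_y (F_ n y * G y) @[n --> \oo] --> \int[m]_y (F y * G y).
Proof.
move=> mT bF_ bG FM FF; have bF := bounded_meas_lim bF_ FM FF.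
have iFG := bounded_meas_integrable mT (bounded_measM bF bG).
apply: fine_cvg; rewrite fineK; last exact: integrable_fin_num iFG.
have [N GN] := bG.2.
have [] := @dominated_convergence _ _ _ m setT measurableT
  (fun n y => (F_ n y * G y)%:E) (fun y => (F y * G y)%:E) (cst (M * N)%:E) => //.
- by move=> n; apply/measurable_EFinP; exact: (bounded_measM (bF_ n) bG).1.
- by apply/measurable_EFinP; exact: (bounded_measM bF bG).1.
- apply: nearW => y _; apply: cvg_EFin; first exact: nearW.
  by apply: cvgM; [exact: FF|exact: cvg_cst].
- apply: (@bounded_meas_integrable m (cst (M * N))) => //; exact: bounded_meas_cst.
- by apply: nearW => y n _ /=; rewrite lee_fin normrM ler_pM.
Qed.

Lemma cos_indist_lim (F_ : nat -> T -> R) F (M : R) :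
  (forall n, cos_indist (F_ n)) -> (forall n y, `|F_ n y| <= M) ->
  (forall y, F_ n y @[n --> \oo] --> F y) -> cos_indist F.
Proof.
move=> cF FM FF; have bF n : bounded_meas (F_ n) by exact: (cF n).1.
split; first exact: bounded_meas_lim bF FM FF.
move=> l b; have bc := bounded_meas_cos l b.
have := bounded_meas_dct m2T bF bc FM FF.
have := bounded_meas_dct m1T bF bc FM FF.
rewrite (_ : (fun n => _) = (fun n => \int[m2]_y (F_ n y * cos (lin l y + b)))).
  by move=> /cvg_unique; apply.
by apply/funext => n; exact: (cF n).2.
Qed.

(* The multipliers form an algebra which is closed under bounded pointwise limits
   and contains the characters, hence the indicators of cylinders. *)
Definition multiplier F := bounded_meas F /\ forall G, cos_indist G -> cos_indist (F \* G).

Lemma multiplierD F G : multiplier F -> multiplier G -> multiplier (F \+ G).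
Proof.
move=> [bF mF] [bG mG]; split; first exact: bounded_measD.
move=> H cH; rewrite (_ : _ \* H = (F \* H) \+ (G \* H)).
  by apply: cos_indistD; [exact: mF|exact: mG].
by apply/funext => y /=; rewrite mulrDl.
Qed.

Lemma multiplierM F G : multiplier F -> multiplier G -> multiplier (F \* G).
Proof.
move=> [bF mF] [bG mG]; split; first exact: bounded_measM.
move=> H cH; rewrite (_ : _ \* H = F \* (G \* H)).
  by apply: mF; exact: mG.
by apply/funext => y /=; rewrite mulrA.
Qed.

Lemma multiplierZ (a : R) F : multiplier F -> multiplier (fun y => a * F y).
Proof.
move=> [bF mF]; split; first by apply: (@bounded_measM (cst a)) => //; exact: bounded_meas_cst.
move=> H cH; rewrite (_ : _ \* H = (fun y => a * (F \* H) y)).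
  by apply: cos_indistZ; exact: mF.
by apply/funext => y /=; rewrite mulrA.
Qed.

Lemma multiplier_cst (a : R) : multiplier (cst a).
Proof. by split; [exact: bounded_meas_cst|move=> H cH; exact: cos_indistZ]. Qed.

Lemma multiplier_lim (F_ : nat -> T -> R) F (M : R) :
  (forall n, multiplier (F_ n)) -> (forall n y, `|F_ n y| <= M) ->
  (forall y, F_ n y @[n --> \oo] --> F y) -> multiplier F.
Proof.
move=> mF FM FF; split; first exact: (bounded_meas_lim (fun n => (mF n).1) FM FF).
move=> G cG; have [N GN] := cG.1.2.
apply: (@cos_indist_lim (fun n => F_ n \* G) _ (M * N)).
- by move=> n; exact: (mF n).2.
- by move=> n y; rewrite normrM ler_pM.
- by move=> y; apply: cvgM => //; exact: cvg_cst.
Qed.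

(** The product formula for two cosines turns the extra factor into a shift of the linear form by
    [t] or [- t] at coordinate [i], and [G] is tested against both shifted forms. *)
Lemma multiplier_cos (t b : R) i : multiplier (fun y => cos (t * y i + b)).
Proof.
have bc : bounded_meas (fun y => cos (t * y i + b)).
  have := bounded_meas_cos [:: (t, i)] b; rewrite /lin.
  by under eq_fun do rewrite big_seq1.
split=> // G cG; split; first exact: bounded_measM bc cG.1.
move=> l c.
have E (m : {measure set T -> \bar R}) : m setT = 1%E ->
    \int[m]_y (cos (t * y i + b) * G y * cos (lin l y + c)) =
    2^-1 * (\int[m]_y (G y * cos (lin ((t, i) :: l) y + (b + c))) +
    \int[m]_y (G y * cos (lin ((- t, i) :: l) y + (c - b)))).
  move=> mT; have iG k e : m.-integrable setT (EFin \o (fun y => G y * cos (lin k y + e))).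
    by apply: bounded_meas_integrable => //; apply: bounded_measM cG.1 _; exact: bounded_meas_cos.
  rewrite -RintegralD// -RintegralZl//; last first.
    apply: bounded_meas_integrable => //; apply: bounded_measD;
    by apply: bounded_measM cG.1 _; exact: bounded_meas_cos.
  apply: eq_Rintegral => y _; rewrite /lin !big_cons/= -!/(lin l y).
  rewrite (_ : _ + (b + c) = (lin l y + c) + (t * y i + b)); last by ring.
  rewrite (_ : _ + (c - b) = (lin l y + c) - (t * y i + b)); last by ring.
  move: (lin l y + c) (t * y i + b) => u v.
  by rewrite cosD cosB; field.
by rewrite /= E// E// !cG.2.
Qed.

Lemma multiplier_smoothstep F :
  multiplier F -> multiplier (fun y => smoothstep (F y)).
Proof.
move=> mF.
rewrite (_ : (fun y => _) = (fun y => 3 / 2 * F y) \+ (fun y => - 2^-1 * (F \* F \* F) y)).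
  apply: multiplierD; apply: multiplierZ => //.
  by apply: multiplierM => //; exact: multiplierM.
by apply/funext => y /=; rewrite /smoothstep; field.
Qed.

Lemma multiplier_iter_smoothstep F n :
  multiplier F -> multiplier (fun y => iter n smoothstep (F y)).
Proof. by move=> mF; elim: n => // n; exact: multiplier_smoothstep. Qed.

Lemma multiplier_sgcos (t b : R) i :
  multiplier (fun y => Num.sg (cos (t * y i + b))).
Proof.
have c1 (y : T) : `|cos (t * y i + b)| <= 1 by rewrite ler_norml cos_geN1 cos_le1.
apply: (@multiplier_lim (fun n y => iter n smoothstep (cos (t * y i + b))) _ 1).
- by move=> n; apply: multiplier_iter_smoothstep; exact: multiplier_cos.
- by move=> n y; exact: iter_smoothstep_norm.
- by move=> y; exact: iter_smoothstep_cvg.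
Qed.

(** With [u = (y i - a) / n.+1] the cosine below is [sin u]. For large [n], [|u| < pi] and its sign
    is that of [y i - a], so the sequence is eventually constant at each [y]. *)
Lemma multiplier_sg (a : R) i : multiplier (fun y => Num.sg (y i - a)).
Proof.
apply: (@multiplier_lim (fun n y =>
  Num.sg (cos (n.+1%:R^-1 * y i + (- (n.+1%:R^-1 * a) - pi / 2)))) _ 1).
- by move=> n; exact: multiplier_sgcos.
- by move=> n y; rewrite normr_sg; case: (_ != _).
move=> y; apply: cvg_near_cst.
near=> n.
rewrite addrA -mulrBr cosBpihalf sgr_sin.
  by rewrite sgrM gtr0_sg ?mul1r.
rewrite normrM gtr0_norm// mulrC ltr_pdivrMr// mulrC -ltr_pdivrMr ?pi_gt0//.
rewrite (@lt_trans _ _ n%:R) ?ltr_nat//.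
near: n; exact: nbhs_infty_gtr.
Unshelve. all: by end_near. Qed.

(** With [s] the sign of [y i - a], the indicator of [s = -1] is the polynomial
    [(s ^+ 2 - s) / 2]. *)
Lemma multiplier_lt (a : R) i : multiplier (fun y => ((y i < a)%R : nat)%:R).
Proof.
rewrite (_ : (fun y => _) =
    (fun y => 2^-1 * ((fun y => Num.sg (y i - a)) \* (fun y => Num.sg (y i - a))) y) \+
    (fun y => - 2^-1 * Num.sg (y i - a))).
  by apply: multiplierD; apply: multiplierZ; [apply: multiplierM|]; exact: multiplier_sg.
apply/funext => y /=; rewrite -subr_lt0; case: (ltrgt0P (y i - a)) => [ya|ya|->].
- by rewrite gtr0_sg//=; field.
- by rewrite ltr0_sg//=; field.
- by rewrite sgr0/=; field.
Qed.

Definition below (s : seq (I * R)) : set T := [set y | all (fun p => y p.1 < p.2) s].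

Lemma multiplier_below s : multiplier (\1_(below s)).
Proof.
elim: s => [|p s IH].
  suff -> : \1_(below [::]) = (fun=> 1) :> (T -> R) by exact: multiplier_cst.
  by apply/funext => y; rewrite indicE mem_set.
rewrite (_ : \1__ = (fun y => ((y p.1 < p.2)%R : nat)%:R) \* \1_(below s)).
  by apply: multiplierM => //; exact: multiplier_lt.
apply/funext => y; rewrite /= !indicE -natrM mulnb; congr (nat_of_bool _)%:R.
by apply/idP/andP; rewrite !inE /below/=; [move=> /andP|move=> [-> ->]].
Qed.

Lemma measurable_below s : measurable (below s).
Proof.
have [[m _] _] := multiplier_below s.
have := m measurableT [set 1] (measurable_set1 1).
rewrite setTI (_ : _ @^-1` _ = below s)//.
apply/seteqP; split => y /=; rewrite indicE.
  by case: (boolP (y \in _)) => [/set_mem//|_ /eqP]; rewrite eq_sym oner_eq0.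
by move=> ys; rewrite mem_set.
Qed.

(** The indicator multiplies the constant [1], and the empty linear form with phase [0] has cosine
    [1]. *)
Lemma measure_below s : m1 (below s) = m2 (below s).
Proof.
have [_ /(_ _ cos_indist1) [_ /(_ [::] 0)]] := multiplier_below s.
under eq_Rintegral do rewrite /lin big_nil addr0 cos0 mulr1 /= mulr1.
under [RHS]eq_Rintegral do rewrite /lin big_nil addr0 cos0 mulr1 /= mulr1.
rewrite /Rintegral !integral_indic ?setIT//; try exact: measurable_below.
have mb := measurable_below s.
have fin (m : {measure set T -> \bar R}) : m setT = 1%E -> m (below s) \is a fin_num.
  move=> mT; rewrite ge0_fin_numE// (@le_lt_trans _ _ (m setT))//.
    by apply: le_measure; rewrite ?inE.
  by rewrite mT ltry.
by move=> /(congr1 (@EFin R)); rewrite !fineK ?fin.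
Qed.

Lemma measurable_cyl_below : @measurable _ T = <<s range below >>.
Proof.
have mcoord i : measurable_fun setT (fun y : g_sigma_algebraType (range below) => y i).
  apply: (measurability _ (RGenInftyO.measurableE R)) => _ [_ [x ->] <-].
  rewrite setTI; apply: sub_sigma_algebra; exists [:: (i, x)] => //.
  by apply/seteqP; split => y; rewrite /below/= in_itv/= andbT.
apply/seteqP; split; apply: smallest_sub.
- exact: smallest_sigma_algebra.
- by move=> _ [i [B [mB ->]]]; have := mcoord i measurableT B mB; rewrite setTI.
- exact: smallest_sigma_algebra.
- by move=> _ [s _ <-]; exact: measurable_below.
Qed.

(** Uniqueness of measures on a generating family stable under intersection: intersecting two sets
    [below] concatenates their lists of constraints. *)
Lemma cyl_measure_unique A : measurable A -> m1 A = m2 A.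
Proof.
apply: (measure_unique (range below) (fun=> setT)).
- exact: measurable_cyl_below.
- move=> _ _ [s _ <-] [t _ <-]; exists (s ++ t) => //.
  apply/seteqP; split => y; rewrite /below/= all_cat.
    by move=> /andP.
  by move=> [-> ->].
- by move=> _; exists [::] => //; apply/seteqP.
- exact: bigcup_const.
- by move=> _ [s _ <-]; exact: measure_below.
- by move=> _; rewrite m1T ltry.
Qed.

End cylinder_sets.

(** * Square-integrable functions *)

Section square_integrable.
Context d (O : measurableType d) {R : realType} (m : {measure set O -> \bar R}).
Implicit Types f g : O -> R.

Definition sqint f := measurable_fun setT f /\
  m.-integrable setT (fun x => (f x ^+ 2)%:E).

Lemma sqintM f g : sqint f -> sqint g -> m.-integrable setT (fun x => (f x * g x)%:E).
Proof.
move=> [mf if2] [mg ig2].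
apply: le_integrable (integrableD measurableT if2 ig2) => //.
  by apply/measurable_EFinP; exact: measurable_funM.
move=> x _ /=; rewrite lee_fin normrM (ger0_norm (addr_ge0 _ _)) ?sqr_ge0//.
rewrite -[f x ^+ 2]real_normK ?num_real// -[g x ^+ 2]real_normK ?num_real//.
have := normr_ge0 (f x); have := normr_ge0 (g x).
by move: `|f x| `|g x| => a b; nra.
Qed.

Lemma sqintZ (a : R) f : sqint f -> sqint (fun x => a * f x).
Proof.
move=> [mf if2]; split; first exact: measurable_funM.
under eq_fun do rewrite exprMn EFinM.
exact: integrableZl.
Qed.

Lemma sqintD f g : sqint f -> sqint g -> sqint (fun x => f x + g x).
Proof.
move=> sf sg; split; first exact: measurable_funD sf.1 sg.1.
under eq_fun do rewrite sqrrD 2!EFinD -mulr_natl EFinM.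
apply: integrableD => //; last exact: sg.2.
apply: integrableD => //; first exact: sf.2.
rewrite (_ : (fun x => _) = (fun x => 2%:E * (f x * g x)%:E)%E) //.
by apply: integrableZl => //; exact: sqintM.
Qed.

Hypothesis mT : (m setT < +oo)%E.

Lemma sqint_cst (a : R) : sqint (fun=> a).
Proof.
split => //; apply: (@measurable_bounded_integrable _ _ _ m (fun=> a ^+ 2)) => //.
exists `|a ^+ 2|; split; first exact: num_real.
by move=> x x1 y _ /=; rewrite ltW.
Qed.

Lemma sqint_sum (J : Type) (s : seq J) (F : J -> O -> R) :
  (forall j, sqint (F j)) -> sqint (fun x => \sum_(j <- s) F j x).
Proof.
move=> sF; elim: s => [|j s IH].
  by under eq_fun do rewrite big_nil; exact: sqint_cst.
by under eq_fun do rewrite big_cons; exact: sqintD.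
Qed.

Lemma sqint_integrable f : sqint f -> m.-integrable setT (EFin \o f).
Proof.
move=> sf; have := sqintM sf (sqint_cst 1); rewrite (_ : (fun x => _) = (EFin \o f))//.
by apply/funext => x /=; rewrite mulr1.
Qed.

End square_integrable.

(** * Centred Gaussian processes and their covariance kernels *)

Section gaussian_process.
Context {R : realType} {I : Type}.
Local Notation T := (g_sigma_algebraType (@cyl R I)).

(** The variance of [lin l] when the coordinates have covariance kernel [K]. *)
Definition quad (K : I -> I -> R) (l : seq (R * I)) :=
  \sum_(p <- l) \sum_(q <- l) p.1 * q.1 * K p.2 q.2.

Definition gaussian_process d (O : measurableType d) (W : probability O R)
    (X : I -> O -> R) (K : I -> I -> R) :=
  forall l, centered_gaussian W (fun w => lin l (X ^~ w)) (quad K l).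

Lemma gaussian_process_measurable d (O : measurableType d) (W : probability O R) X K :
  gaussian_process W X K -> measurable_fun setT (fun w => X ^~ w : T).
Proof.
move=> gX; apply: measurable_fun_cyl => i.
have := (gX [:: (1, i)]).1.
by under eq_fun do rewrite /lin big_seq1/= mul1r.
Qed.

Lemma gaussian_processD d1 d2 (O1 : measurableType d1) (O2 : measurableType d2)
    (W1 : probability O1 R) (W2 : probability O2 R) X1 X2 K1 K2 :
  gaussian_process W1 X1 K1 -> gaussian_process W2 X2 K2 ->
  gaussian_process (W1 \x W2)%E (fun i w => X1 i w.1 + X2 i w.2)
    (fun i j => K1 i j + K2 i j).
Proof.
move=> g1 g2 l.
have -> : quad (fun i j => K1 i j + K2 i j) l = quad K1 l + quad K2 l.
  rewrite /quad -big_split/=; apply: eq_bigr => p _.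
  by rewrite -big_split/=; apply: eq_bigr => q _; rewrite mulrDr.
rewrite (_ : (fun w => _) = (fun w => lin l (X1 ^~ w.1) + lin l (X2 ^~ w.2))).
  exact: (centered_gaussianD (g1 l) (g2 l)).
by apply/funext => w; rewrite /lin -big_split/=; apply: eq_bigr => p _; rewrite mulrDr.
Qed.

(** The tool for replacing a process by another one, possibly on another space, with the same
    kernel. Each linear form is centred Gaussian with variance [quad K l], hence has the same law
    under both; so the cosine integrals agree and [cyl_measure_unique] applies. *)
Lemma gaussian_process_integral d1 d2 (O1 : measurableType d1) (O2 : measurableType d2)
    (W1 : probability O1 R) (W2 : probability O2 R) X1 X2 K1 K2 (F : T -> \bar R) :
  gaussian_process W1 X1 K1 -> gaussian_process W2 X2 K2 -> K1 =2 K2 ->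
  measurable_fun setT F -> (forall y, (0 <= F y)%E) ->
  (\int[W1]_w F (X1 ^~ w) = \int[W2]_w F (X2 ^~ w))%E.
Proof.
move=> g1 g2 K12 mF F0.
have m1 := gaussian_process_measurable g1; have m2 := gaussian_process_measurable g2.
rewrite -(ge0_integral_image W1 m1 mF F0) -(ge0_integral_image W2 m2 mF F0).
apply: eq_measure_integral => A mA _.
have i1 : image_measure W1 m1 setT = 1%E by exact: (probability_setT W1).
have i2 : image_measure W2 m2 setT = 1%E by exact: (probability_setT W2).
apply: cyl_measure_unique => // l b.
have mc : measurable_fun setT (fun x : R => cos (x + b)).
  apply: continuous_measurable_fun => x; apply: continuous_comp; last exact: continuous_cos.
  by apply: (@cvgD R R^o); [exact: cvg_id|exact: cvg_cst].
have E (m : {measure set T -> \bar R}) : m setT = 1%E ->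
    \int[m]_y cos (lin l y + b) = \int[image_measure m (measurable_lin l)]_x cos (x + b).
  move=> mT; rewrite /Rintegral; congr fine; apply/esym.
  rewrite integral_pushforward ?preimage_setT//; first exact: measurable_lin.
  - by apply/measurable_EFinP.
  - by apply: bounded_meas_integrable => //; exact: bounded_meas_cos.
rewrite !E//; congr fine; apply: eq_measure_integral => B mB _.
rewrite /=.
have K12l : quad K1 l = quad K2 l.
  by apply: eq_bigr => p _; apply: eq_bigr => q _; rewrite K12.
have g2l := g2 l; rewrite -K12l in g2l.
exact: (centered_gaussian_law (g1 l) g2l mB).
Qed.

End gaussian_process.

(** * The isonormal process as a source of Gaussian processes *)

Section isonormal.
Context d (X : measurableType d) (R : realType) (P : probability X R).
Context d' (Omega : measurableType d') (W : probability Omega R).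
Variables (T : set (L2 P)) (Delta : L2 P -> {RV W >-> R}).
Hypothesis isoDelta : isonormal T Delta.

Lemma isonormal_mean g : T g -> (\int[W]_w (Delta g w)%:E = 0)%E.
Proof. by move=> Tg; have [_ /(_ _ Tg) + _] := isoDelta; rewrite expectation.unlock. Qed.

Lemma isonormal_cov g g' : T g -> T g' ->
  (\int[W]_w (Delta g w * Delta g' w)%:E = (ip g g')%:E)%E.
Proof.
move=> Tg Tg'; have [_ E0 /(_ _ _ Tg Tg') <-] := isoDelta.
rewrite covariance.unlock E0// E0//= expectation.unlock.
by apply: eq_integral => w _; rewrite !fctE /= !subr0.
Qed.

Lemma isonormal_sqint g : T g -> sqint W (Delta g).
Proof.
move=> Tg; split=> //; apply/integrableP; split.
  by apply/measurable_EFinP; exact: measurable_funX.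
under eq_integral => w _ do rewrite gee0_abs ?lee_fin ?sqr_ge0// expr2.
by rewrite isonormal_cov// ltry.
Qed.

(** The coefficients and the family [u] are free, repetitions included: the processes compared in
    the two bounds are sums of such processes on separate factors. *)
Lemma isonormal_gaussian_process (I : Type) (a : I -> R) (u : I -> L2 P) :
  (forall i, T (u i)) ->
  gaussian_process W (fun i w => a i * Delta (u i) w)
    (fun i j => a i * a j * ip (u i) (u j)).
Proof.
move=> Tu l.
have W1 : (W setT < +oo)%E by rewrite probability_setT ltry.
have sqp (p : R * I) : sqint W (fun w => p.1 * (a p.2 * Delta (u p.2) w)).
  by do 2 apply: sqintZ; exact: isonormal_sqint.
have sql : sqint W (fun w => lin l (fun i => a i * Delta (u i) w)).
  exact: (sqint_sum W1 l sqp).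
apply: is_gaussian_centered.
- have [+ _ _] := isoDelta.
  move=> /(_ (size l) (fun k => (tnth (in_tuple l) k).1 * a (tnth (in_tuple l) k).2)
             (fun k => u (tnth (in_tuple l) k).2) (fun=> Tu _)).
  congr is_gaussian; apply/funext => w; rewrite /lin [RHS]big_tnth.
  by apply: eq_bigr => k _; rewrite mulrA.
- exact: sqint_integrable.
- rewrite /lin; under eq_integral do rewrite -sumEFin.
  rewrite integral_sum//; last by move=> p; exact: (sqint_integrable W1 (sqp p)).
  rewrite big1// => p _.
  under eq_integral do rewrite mulrA EFinM.
  rewrite integralZl ?isonormal_mean ?mule0//.
  exact: (sqint_integrable W1 (isonormal_sqint (Tu _))).
- under eq_integral do rewrite expr2 /lin big_distrlr/= -sumEFin.
  rewrite integral_sum//; last first.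
    move=> p; under eq_fun do rewrite -sumEFin; apply: integrable_sum => // q _.
    exact: sqintM.
  rewrite /quad -sumEFin; apply: eq_bigr => p _.
  under eq_integral do rewrite -sumEFin.
  rewrite integral_sum//; last by move=> q; exact: sqintM.
  rewrite -sumEFin; apply: eq_bigr => q _.
  under eq_integral => w _.
    rewrite (_ : _ * _ =
      p.1 * q.1 * (a p.2 * a q.2) * (Delta (u p.2) w * Delta (u q.2) w)); last by ring.
    rewrite EFinM; over.
  rewrite integralZl//; last by apply: sqintM; exact: isonormal_sqint.
  by rewrite isonormal_cov// -EFinM; congr EFin; ring.
Qed.

End isonormal.

(** * Projections in L2 *)

Section inner_product.
Context d (X : measurableType d) (R : realType) (P : probability X R).
Implicit Types (f g h : L2 P) (S : set (L2 P)).

Lemma L2_sqint f : sqint P f.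
Proof.
split; first exact: measurable_funPT.
exact: (Lfun2_integrable_sqr (LfunP f)).
Qed.

Lemma sqint_L2 (u : X -> R) : sqint P u -> exists f : L2 P, f = u :> (X -> R).
Proof.
move=> [mu iu2].
have uL : u \in Lfun P 2%:E.
  rewrite inE; apply/andP; split; rewrite inE//=.
  rewrite /finite_norm unlock poweR_lty//.
  have [_] := integrableP _ _ _ iu2.
  by under eq_integral => x _ do
    rewrite /= ger0_norm ?sqr_ge0// -real_normK ?num_real// -powR_mulrn//.
by exists (Lfun_Sub (lee1n 2) uL).
Qed.

Lemma ipE f g : (ip f g)%:E = (\int[P]_x (f x * g x)%:E)%E.
Proof.
rewrite fineK//; apply: integrable_fin_num => //.
by apply: sqintM; exact: L2_sqint.
Qed.

Lemma ipC f g : ip f g = ip g f.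
Proof. by apply: eq_Rintegral => x _; rewrite mulrC. Qed.

Lemma ipDl f g h : ip (f + g) h = ip f h + ip g h.
Proof.
rewrite -RintegralD//; [|by apply: sqintM; exact: L2_sqint..].
by apply: eq_Rintegral => x _; rewrite mulrDl.
Qed.

Lemma ipZl (a : R) f g : ip (a *: f) g = a * ip f g.
Proof.
rewrite -RintegralZl//; last by apply: sqintM; exact: L2_sqint.
by apply: eq_Rintegral => x _; rewrite mulrA.
Qed.

Lemma ipNl f g : ip (- f) g = - ip f g.
Proof. by rewrite -scaleN1r ipZl mulN1r. Qed.

Lemma ipDr f g h : ip h (f + g) = ip h f + ip h g.
Proof. by rewrite ipC ipDl !(ipC h). Qed.

Lemma ipZr (a : R) f g : ip f (a *: g) = a * ip f g.
Proof. by rewrite ipC ipZl ipC. Qed.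

Lemma ipNr f g : ip f (- g) = - ip f g.
Proof. by rewrite ipC ipNl ipC. Qed.

Lemma ip0l f : ip 0 f = 0.
Proof. by rewrite -[X in ip X _](scale0r f) ipZl mul0r. Qed.

Lemma ip_ge0 f : 0 <= ip f f.
Proof. by apply: Rintegral_ge0 => x _; rewrite -expr2 sqr_ge0. Qed.

Lemma L2norm_sqr f : L2norm f ^+ 2 = ip f f.
Proof.
rewrite /L2norm -powR_mulrn ?fine_ge0 ?Lnorm_ge0//.
apply: EFin_inj; rewrite -poweR_EFin finite_norm_fine poweR_Lnorm// ipE.
by apply: eq_integral => x _; rewrite /= powR_mulrn// real_normK ?num_real// expr2.
Qed.

(** The squared norm of [f - (s * c) *: g] is nonnegative for both signs [s]. With [c] free this
    takes the place of the Cauchy-Schwarz inequality. *)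
Lemma ip_young f g (c : R) : 0 < c -> 2 * c * `|ip f g| <= ip f f + c ^+ 2 * ip g g.
Proof.
move=> c0; have H (s : R) : s ^+ 2 = 1 -> 2 * c * (s * ip f g) <= ip f f + c ^+ 2 * ip g g.
  move=> s1; have := ip_ge0 (f - (s * c) *: g).
  rewrite !(ipDl, ipDr, ipNl, ipNr, ipZl, ipZr) (ipC g f).
  have -> : ip f f - s * c * ip f g + (- (s * c * ip f g) - - (s * c * (s * c * ip g g))) =
    ip f f + s ^+ 2 * c ^+ 2 * ip g g - 2 * c * (s * ip f g) by ring.
  by rewrite s1 mul1r subr_ge0.
have := H 1 (expr1n _ _); have := H (-1); rewrite sqrrN expr1n => /(_ erefl).
rewrite mul1r mulN1r => HN HP; have [p0|p0] := lerP 0 (ip f g).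
  by rewrite ger0_norm.
by rewrite ltr0_norm.
Qed.

End inner_product.

(** * Completeness of L2 *)

Section completeness.
Context d (X : measurableType d) (R : realType) (P : probability X R).
Implicit Types (f g h : L2 P).

Lemma limn_einf_le (u : (\bar R)^nat) (b : \bar R) :
  (forall n, (u n <= b)%E) -> (limn_einf u <= b)%E.
Proof.
move=> ub; rewrite limn_einf_lim; apply: lime_le; first exact: is_cvg_einfs.
apply: nearW => n; apply: le_trans (ub n).
by apply: ereal_inf_lbound; exists n => /=.
Qed.

Lemma limn_einf_ge0 (u : (\bar R)^nat) : (forall n, (0 <= u n)%E) -> (0 <= limn_einf u)%E.
Proof.
move=> u0; rewrite limn_einf_lim; apply: lime_ge; first exact: is_cvg_einfs.
by apply: nearW => n; apply: le_ereal_inf_tmp => _ [k _ <-].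
Qed.

Lemma measurable_fun_limn_einf (u : (X -> \bar R)^nat) :
  (forall n, measurable_fun setT (u n)) ->
  measurable_fun setT (fun x => limn_einf (u ^~ x)).
Proof.
move=> mu; apply: measurableT_comp => //.
apply: (@measurable_fun_limn_esup _ _ _ _ (fun n x => - u n x)%E) => n.
exact: measurableT_comp.
Qed.

(** The Riesz-Fischer argument for a geometric Cauchy rate: the increments are summable almost
    everywhere, and Fatou's lemma passes the rate on to the pointwise limit. *)
Lemma L2_complete (s : nat -> L2 P) (C : R) : 0 <= C ->
  (forall n k, ip (s (n + k)%N - s n) (s (n + k)%N - s n) <= C * (4^-1) ^+ n) ->
  exists f : L2 P, forall n, ip (f - s n) (f - s n) <= C * (4^-1) ^+ n.
Proof.
move=> C0 sC.
have P1 : (P setT < +oo)%E by rewrite probability_setT ltry.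
pose D k x := `|s k.+1 x - s k x|.
have D0 k x : (0 <= (D k x)%:E)%E by rewrite lee_fin /D.
have mD k : measurable_fun setT (fun x => (D k x)%:E).
  apply/measurable_EFinP; apply: measurableT_comp => //.
  by apply: measurable_funB; exact: measurable_funPT.
(* Pointwise [a <= 2 ^+ k * a ^+ 2 + 2^-1 ^+ k], and the integral of the square is at most
   [C * 4^-1 ^+ k]. *)
have intD k : (\int[P]_x (D k x)%:E <= ((C + 1) * 2^-1 ^+ k)%:E)%E.
  have iD : P.-integrable setT (fun x => ((s k.+1 - s k) x ^+ 2)%:E) by exact: (L2_sqint _).2.
  have i1 : P.-integrable setT (fun=> (2^-1 ^+ k)%:E).
    exact: (sqint_integrable P1 (sqint_cst P1 _)).
  apply: (@le_trans _ _
    (\int[P]_x ((2 ^+ k)%:E * ((s k.+1 - s k) x ^+ 2)%:E + (2^-1 ^+ k)%:E))%E).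
    apply: ge0_le_integral => //.
    - by apply: emeasurable_funD => //; apply: emeasurable_funM => //; exact: measurable_int iD.
    - move=> x _; rewrite -EFinM -EFinD lee_fin /D.
      rewrite (_ : (s k.+1 - s k) x = s k.+1 x - s k x)// -real_normK ?num_real//.
      have c0 : 0 < (2 : R) ^+ k by rewrite exprn_gt0.
      rewrite exprVn; move: (2 ^+ k) c0 (normr_ge0 (s k.+1 x - s k x)) => c c0.
      move: `|_| => a a0; have cV : c * c^-1 = 1 by rewrite divff ?gt_eqF.
      have : 0 < c^-1 by rewrite invr_gt0.
      move: c^-1 cV => e ce e0; have := mulr_ge0 (ltW c0) (sqr_ge0 (a - e / 2)).
      rewrite (_ : c * _ = c * a ^+ 2 - a * (c * e) + c * e * e / 4); last by field.
      by rewrite ce; lra.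
  rewrite integralD//; last exact: integrableZl.
  rewrite integralZl// integral_cst// [X in (_ + _ * X)%E](_ : _ = 1%E);
    last exact: (probability_setT P).
  rewrite mule1.
  rewrite (_ : (\int[P]_x _)%E = (ip (s k.+1 - s k) (s k.+1 - s k))%:E); last first.
    by rewrite ipE; apply: eq_integral => x _; rewrite expr2.
  rewrite -EFinM -EFinD lee_fin mulrDl mul1r lerD2r.
  have := sC k 1%N; rewrite addn1 => h.
  apply: (@le_trans _ _ (2 ^+ k * (C * 4^-1 ^+ k))).
    by rewrite ler_pM2l// exprn_gt0.
  rewrite mulrCA -exprMn (_ : 2 * 4^-1 = 2^-1)//; by field.
pose G x := (\sum_(0 <= k <oo) (D k x)%:E)%E.
have intG : (\int[P]_x G x <= (2 * (C + 1))%:E)%E.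
  rewrite integral_nneseries//.
  apply: lime_le; first by apply: is_cvg_nneseries => n _ _; exact: integral_ge0.
  apply: nearW => n.
  (* This is the [n]-th partial sum of the geometric series with first term [C + 1] and ratio
     [2^-1]. *)
  apply: (@le_trans _ _ (2 * (C + 1) * (1 - 2^-1 ^+ n))%:E); last first.
    have e0 : 0 <= (2^-1 : R) ^+ n by rewrite exprn_ge0.
    by rewrite lee_fin; move: (2^-1 ^+ n) e0 => e e0; nra.
  elim: n => [|n IH]; first by rewrite big_nil expr0 subrr mulr0.
  rewrite big_nat_recr//=; apply: le_trans (leeD IH (intD n)) _.
  rewrite -EFinD lee_fin exprS; by move: (2^-1 ^+ n) => e; lra.
have iG : P.-integrable setT G.
  apply/integrableP; split.
    by apply: ge0_emeasurable_sum.
  apply: le_lt_trans (ltry (2 * (C + 1))).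
  under eq_integral => x _ do rewrite gee0_abs ?nneseries_ge0//.
  exact: intG.
have cvs : {ae P, forall x, cvgn (fun n => s n x)}.
  apply: filterS (integrable_ae measurableT iG) => x /(_ I) Gx.
  suff cv : cvgn (series (telescope (fun n => s n x))).
    rewrite (_ : (fun n => _) = (fun n => s 0%N x + series (telescope (fun n => s n x)) n)).
      by apply: is_cvgD => //; exact: is_cvg_cst.
    by apply/funext => n; rewrite -eq_sum_telescope.
  apply: normed_cvg; apply: nondecreasing_is_cvgn.
    by apply/nondecreasing_series => n _ _; exact: normr_ge0.
  exists (fine (G x)) => _ [n _ <-].
  rewrite -lee_fin fineK// /series/= -sumEFin.
  by apply: nneseries_lim_ge => k _ _; exact: D0.
(* An upper limit is measurable everywhere; [fine] only alters infinite values, which occur on a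
   null set. *)
pose f x := fine (limn_esup (fun n => (s n x)%:E)).
have mf : measurable_fun setT f.
  apply: (measurableT_comp (fine_measurable measurableT)).
  by apply: measurable_fun_limn_esup => n; apply/measurable_EFinP; exact: measurable_funPT.
have fE : {ae P, forall x, (fun n => s n x) @ \oo --> f x}.
  apply: filterS cvs => x cx.
  have cE : (fun n => (s n x)%:E) @ \oo --> (limn (fun n => s n x))%:E.
    by apply: cvg_EFin => //; exact: nearW.
  by rewrite /f (cvg_limn_einf_sup cE).2.
have fs n : (\int[P]_x ((f x - s n x) ^+ 2)%:E <= (C * 4^-1 ^+ n)%:E)%E.
  have mfs : measurable_fun setT (fun x => ((f x - s n x) ^+ 2)%:E).
    apply/measurable_EFinP; apply: measurable_funX; apply: measurable_funB; first exact: mf.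
    exact: measurable_funPT.
  have mss k : measurable_fun setT (fun x => ((s (n + k)%N x - s n x) ^+ 2)%:E).
    exact: (measurable_int P (L2_sqint (s (n + k)%N - s n)).2).
  (* Almost everywhere the integrand is the limit in [k] of the same square with [s (n + k)] in
     place of [f], which prepares Fatou's lemma. *)
  rewrite (@ge0_ae_eq_integral _ _ _ P setT _
      (fun x => limn_einf (fun k => ((s (n + k)%N x - s n x) ^+ 2)%:E)))//; first last.
  - apply: filterS fE => x fx _; apply/esym.
    apply: (cvg_limn_einf_sup _).1; apply: cvg_EFin; first exact: nearW.
    apply: (@cvg_comp _ _ _ (fun k => s (n + k)%N x)
      (fun y : R => (y - s n x) ^+ 2) _ (nbhs (f x))).
      rewrite (_ : (fun k => _) = (fun k => s (k + n)%N x)); last first.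
        by apply/funext => k; rewrite addnC.
      by rewrite (cvg_shiftn n (fun k => s k x)).
    apply: (cvg_comp (fun y : R => y - s n x) (fun y : R => y ^+ 2)).
      by apply: (@cvgB R R^o); [exact: cvg_id|exact: cvg_cst].
    exact: sqr_continuous.
  - by move=> x _; apply: limn_einf_ge0 => k; rewrite lee_fin sqr_ge0.
  - by move=> x _; rewrite lee_fin sqr_ge0.
  - exact: measurable_fun_limn_einf.
  apply: le_trans (fatou P measurableT mss _) _ => [k x _|]; first by rewrite lee_fin sqr_ge0.
  apply: limn_einf_le => k.
  rewrite (_ : (\int[P]_x _)%E = (ip (s (n + k)%N - s n) (s (n + k)%N - s n))%:E).
    by rewrite lee_fin.
  by rewrite ipE; apply: eq_integral => x _; rewrite expr2.
have sf0 : sqint P (fun x => f x - s 0%N x).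
  split; first by apply: measurable_funB; [exact: mf|exact: measurable_funPT].
  apply/integrableP; split.
    apply/measurable_EFinP; apply: measurable_funX; apply: measurable_funB; first exact: mf.
    exact: measurable_funPT.
  under eq_integral => x _ do rewrite gee0_abs ?lee_fin ?sqr_ge0//.
  exact: le_lt_trans (fs 0%N) (ltry _).
have sf : sqint P f.
  have := sqintD sf0 (L2_sqint (s 0%N)).
  by under eq_fun do rewrite subrK.
have [g gf] := sqint_L2 sf; exists g => n.
rewrite -lee_fin ipE; apply: le_trans (fs n).
by rewrite le_eqVlt; apply/orP; left; apply/eqP/eq_integral => x _; rewrite -gf expr2.
Qed.

End completeness.

(** * Orthogonal projection onto a closed subspace *)

Section projection.
Context d (X : measurableType d) (R : realType) (P : probability X R).
Implicit Types (f g h : L2 P) (S T : set (L2 P)).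

Lemma cvg_geo4 (C : R) : C * (4^-1) ^+ n @[n --> \oo] --> 0.
Proof.
rewrite -(mulr0 C); apply: (@cvgM R); first exact: cvg_cst.
by apply: cvg_expr; rewrite ger0_norm//; lra.
Qed.

Lemma linear_subspaceZ S (a : R) f : linear_subspace S -> S f -> S (a *: f).
Proof. by move=> [S0 SL] Sf; rewrite -[a *: f]addr0; exact: SL. Qed.

Lemma linear_subspaceD S f g : linear_subspace S -> S f -> S g -> S (f + g).
Proof. by move=> [S0 SL] Sf Sg; rewrite -[f]scale1r; exact: SL. Qed.

Lemma linear_subspaceB S f g : linear_subspace S -> S f -> S g -> S (f - g).
Proof.
move=> LS Sf Sg; apply: linear_subspaceD => //.
by rewrite -scaleN1r; exact: linear_subspaceZ.
Qed.

(** A minimizing sequence for the distance from [g] to [S] converges, and perturbing it along [h]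
    shows that the residual of its limit is orthogonal to [h]. *)
Lemma projection S g : linear_subspace S -> L2_closed S ->
  exists p, S p /\ forall h, S h -> ip (g - p) h = 0.
Proof.
move=> LS cS.
pose D := [set r | exists2 p, S p & r = ip (g - p) (g - p)].
have D0 : has_inf D.
  split; first by exists (ip (g - 0) (g - 0)); exists 0 => //; exact: LS.1.
  by exists 0 => _ [p _ ->]; exact: ip_ge0.
have Dinf p : S p -> inf D <= ip (g - p) (g - p).
  by move=> Sp; apply: ge_inf; [exact: D0.2|exists p].
have /choice[s sP] n : exists p, S p /\ ip (g - p) (g - p) < inf D + (4^-1) ^+ n.
  have e0 : 0 < (4^-1 : R) ^+ n by rewrite exprn_gt0.
  by have [_ [p Sp ->] lt] := inf_adherent e0 D0; exists p.
have sS n : S (s n) := (sP n).1.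
have sd n : ip (g - s n) (g - s n) <= inf D + (4^-1) ^+ n by exact/ltW/(sP n).2.
have [f fs] : exists f : L2 P, forall n, ip (f - s n) (f - s n) <= 4 * (4^-1) ^+ n.
  apply: L2_complete => // n k.
  (* Parallelogram identity: the midpoint lies in [S], so its distance to [g] is bounded below, and
     the squared distance of the two terms is at most [2 e + 2 e' <= 4 e]. *)
  have := Dinf (2^-1 *: (s (n + k)%N + s n)).
  move=> /(_ (linear_subspaceZ _ LS (linear_subspaceD LS (sS _) (sS _)))).
  have := sd n; have := sd (n + k)%N.
  have : (4^-1 : R) ^+ (n + k) <= 4^-1 ^+ n.
    by rewrite exprD ler_piMr ?exprn_ge0// exprn_ile1//; lra.
  move: (4^-1 ^+ n) (4^-1 ^+ (n + k)) (s n) (s (n + k)%N) => e e' a b.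
  rewrite !(ipDl, ipDr, ipNl, ipNr, ipZl, ipZr) (ipC a g) (ipC b g) (ipC a b).
  by move: (ip g g) (ip g a) (ip g b) (ip a a) (ip b a) (ip b b) => *; lra.
have Sf : S f.
  apply: cS => e e0.
  have e20 : 0 < e ^+ 2 by rewrite exprn_gt0.
  have [n _ Hn] := cvgr_lt _ (cvg_geo4 4) _ e20.
  exists (s n) => //; have := Hn n (leqnn n) => /(le_lt_trans (fs n)).
  by rewrite -L2norm_sqr ltr_pXn2r// nnegrE ?fine_ge0 ?Lnorm_ge0 ?ltW.
exists f; split => // h Sh.
have main (c : R) : 0 < c -> `|ip (g - f) h| <= c * ip h h.
  move=> c0.
  (* The error [5 * 4^-1 ^+ n] collects [4] from the distance of [s n] to [f] and [1] from the
     near-minimality of [s n], tested on the perturbations of [s n] by [c *: h] and its opposite. *)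
  have H n : 2 * c * `|ip (g - f) h| <= 2 * c ^+ 2 * ip h h + 5 * 4^-1 ^+ n.
    have H1 : 2 * c * `|ip (f - s n) h| <= 4 * 4^-1 ^+ n + c ^+ 2 * ip h h.
      by apply: le_trans (ip_young _ _ c0) _; rewrite lerD2r.
    have H2 (a : R) : a ^+ 2 = 1 -> 2 * c * (a * ip (g - s n) h) <= 4^-1 ^+ n + c ^+ 2 * ip h h.
      move=> a1; have := Dinf (s n + (a * c) *: h).
      move=> /(_ (linear_subspaceD LS (sS n) (linear_subspaceZ _ LS Sh))).
      rewrite opprD addrA => lo; have := sd n; move: lo.
      move: (g - s n) => u.
      have -> : ip (u - (a * c) *: h) (u - (a * c) *: h) =
          ip u u - 2 * (c * (a * ip u h)) + a ^+ 2 * (c ^+ 2 * ip h h).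
        by rewrite !(ipDl, ipDr, ipNl, ipNr, ipZl, ipZr) (ipC h u); ring.
      rewrite a1 mul1r -mulrA; move: (c * (a * _)) (c ^+ 2 * _) => *; lra.
    have {}H2 : 2 * c * `|ip (g - s n) h| <= 4^-1 ^+ n + c ^+ 2 * ip h h.
      have := H2 1 (expr1n _ _); have := H2 (-1); rewrite sqrrN expr1n => /(_ erefl).
      rewrite mul1r mulN1r => HN HP; have [p0|p0] := lerP 0 (ip (g - s n) h).
        by rewrite ger0_norm.
      by rewrite ltr0_norm.
    have : `|ip (g - f) h| <= `|ip (g - s n) h| + `|ip (f - s n) h|.
      rewrite (_ : ip (g - f) h = ip (g - s n) h - ip (f - s n) h) ?ler_normB//.
      by rewrite !(ipDl, ipNl); ring.
    by nra.
  have : 2 * c * `|ip (g - f) h| <= 2 * c ^+ 2 * ip h h + 0.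
    have cv : 2 * c ^+ 2 * ip h h + 5 * 4^-1 ^+ n @[n --> \oo] --> 2 * c ^+ 2 * ip h h + 0.
      by apply: (@cvgD R R^o); [exact: cvg_cst|exact: cvg_geo4].
    rewrite -(cvg_lim _ cv)//; apply: limr_ge; first exact: cvgP cv.
    exact: nearW.
  rewrite addr0 (_ : 2 * c ^+ 2 * _ = 2 * c * (c * ip h h)); last by ring.
  by rewrite ler_pM2l// mulr_gt0.
apply/eqP; rewrite -normr_le0; apply/ler_addgt0Pr => e e0; rewrite add0r.
(* The bound [main] is used at [c = e / (ip h h + 1)]; the summand [1] keeps the denominator
   positive. *)
have h1 : 0 < ip h h + 1 by rewrite ltr_wpDl ?ip_ge0.
apply: le_trans (main (e / (ip h h + 1)) _) _; first by rewrite divr_gt0.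
rewrite mulrAC ler_pdivrMr// ler_pM2l//; lra.
Qed.

End projection.

(** * Minimax risks *)

Section experiment.
Context d (X : measurableType d) (R : realType) (P : probability X R).
Context d' (Omega : measurableType d') (W : probability Omega R).
Implicit Types (S T : set (L2 P)) (Delta : L2 P -> {RV W >-> R}).

Lemma measurable_obs S Delta h : measurable_fun setT (@obs _ _ _ P _ _ W S Delta h).
Proof.
apply: measurable_fun_cyl => g; rewrite /obs.
by apply: measurable_funD => //; exact: measurable_funPT.
Qed.

Section loss.
Context d'' (U : measurableType d'') (Q : probability U R).
Context d3 (Z : measurableType d3).
Variables (f : Z * U -> R) (a : R).
Hypothesis mf : measurable_fun setT f.

(** The risk conditional on the observation [z], averaged over the auxiliary variable only. *)
Definition loss (z : Z) : \bar R := (\int[Q]_u ((f (z, u) - a) ^+ 2)%:E)%E.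

Lemma measurable_sqloss : measurable_fun setT (fun zu => ((f zu - a) ^+ 2)%:E).
Proof. by apply/measurable_EFinP; apply: measurable_funX; exact: measurable_funB. Qed.

Lemma measurable_loss : measurable_fun setT loss.
Proof.
apply: (measurable_fun_fubini_tonelli_F (m2 := Q) _ measurable_sqloss) => zu.
by rewrite lee_fin sqr_ge0.
Qed.

Lemma loss_ge0 z : (0 <= loss z)%E.
Proof. by apply: integral_ge0 => u _; rewrite lee_fin sqr_ge0. Qed.

End loss.

Lemma riskE S Delta d'' (U : measurableType d'') (Q : probability U R)
    (f : sample_space S * U -> R) h a : measurable_fun setT f ->
  risk Delta Q f h a = (\int[W]_w loss Q f a (obs Delta h w))%E.
Proof.
move=> mf; rewrite /risk expectation.unlock.
have mo : measurable_fun setT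
    (fun wu : Omega * U => (@obs _ _ _ P _ _ W S Delta h wu.1, wu.2)).
  apply: measurable_fun_pair; last exact: measurable_snd.
  exact: (measurableT_comp (@measurable_obs S Delta h) measurable_fst).
rewrite fubini_tonelli1//.
- by apply: (measurableT_comp (measurable_sqloss a mf)).
- by move=> wu; rewrite lee_fin sqr_ge0.
Qed.

Lemma integral_noise (Y : Omega -> R) (v c : R) : sqint W Y ->
  (\int[W]_w (Y w)%:E = 0)%E -> (\int[W]_w (Y w ^+ 2)%:E = v%:E)%E ->
  (\int[W]_w ((c + Y w) ^+ 2)%:E = v%:E + (c ^+ 2)%:E)%E.
Proof.
move=> sY EY0 EY2; have W1 : (W setT < +oo)%E by rewrite probability_setT ltry.
have iY := sqint_integrable W1 sY.
under eq_integral => w _.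
  rewrite (_ : (c + Y w) ^+ 2 = Y w ^+ 2 + (2 * c * Y w + c ^+ 2)); last by ring.
  rewrite 2!EFinD EFinM; over.
have ic : W.-integrable setT (fun=> (c ^+ 2)%:E).
  exact: (sqint_integrable W1 (sqint_cst W1 _)).
have iZ : W.-integrable setT (fun w => (2 * c)%:E * (Y w)%:E)%E.
  exact: integrableZl.
rewrite integralD//; [|exact: sY.2|exact: integrableD].
rewrite (integralD measurableT iZ ic) (integralZl measurableT iY) EY0 mule0 add0e EY2.
by rewrite integral_cst// [X in (_ * X)%E](_ : _ = 1%E) ?mule1//; exact: probability_setT.
Qed.

(** A centred error independent of the observation and of the randomization adds exactly its
    variance: the cross term in the square has mean zero. Both bounds end with this
    decomposition. *)
Lemma integral_loss_noise d0 (O : measurableType d0) (W0 : probability O R)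
    d'' (U : measurableType d'') (Q : probability U R) (f : O * U -> R)
    (Y : Omega -> R) (v a : R) : measurable_fun setT f -> sqint W Y ->
  (\int[W]_w (Y w)%:E = 0)%E -> (\int[W]_w (Y w ^+ 2)%:E = v%:E)%E ->
  (\int[W0 \x W]_ow \int[Q]_u ((f (ow.1, u) - a + Y ow.2) ^+ 2)%:E =
   v%:E + \int[W0]_o loss Q f a o)%E.
Proof.
move=> mf sY EY0 EY2.
have v0 : (0 <= v%:E)%E by rewrite -EY2; apply: integral_ge0 => w _; rewrite lee_fin sqr_ge0.
have mg : measurable_fun setT (fun owu : (O * Omega) * U =>
    ((f (owu.1.1, owu.2) - a + Y owu.1.2) ^+ 2)%:E).
  apply/measurable_EFinP/measurable_funX/measurable_funD; last first.
    by apply: (measurableT_comp sY.1); exact: measurableT_comp.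
  apply: measurable_funB => //; apply: (measurableT_comp mf).
  apply: measurable_fun_pair; last exact: measurable_snd.
  exact: (measurableT_comp measurable_fst measurable_fst).
rewrite (fubini_tonelli1
  (fun ow => \int[Q]_u ((f (ow.1, u) - a + Y ow.2) ^+ 2)%:E)%E); last 2 first.
- apply: (measurable_fun_fubini_tonelli_F (m2 := Q) _ mg) => owu.
  by rewrite lee_fin sqr_ge0.
- by move=> ow; apply: integral_ge0 => u _; rewrite lee_fin sqr_ge0.
have mf1 o : measurable_fun setT (fun u => f (o, u)).
  by apply: (measurableT_comp mf); exact: measurable_pair1.
transitivity (\int[W0]_o (v%:E + loss Q f a o))%E; last first.
  rewrite ge0_integralD//; last 2 first.
  - by move=> o _; exact: loss_ge0.
  - exact: measurable_loss.
  by rewrite integral_cst// [X in (_ * X + _)%E](_ : _ = 1%E) ?mule1//; exact: probability_setT.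
apply: eq_integral => o _.
etransitivity.
  apply: (fubini_tonelli (m1 := W) (m2 := Q) (fun wu => ((f (o, wu.2) - a + Y wu.1) ^+ 2)%:E)).
    apply/measurable_EFinP/measurable_funX/measurable_funD; last first.
      by apply: (measurableT_comp sY.1).
    by apply: measurable_funB => //; exact: (measurableT_comp (mf1 o)).
  by move=> wu; rewrite lee_fin sqr_ge0.
under eq_integral => u _ do rewrite /= (integral_noise (f (o, u) - a) sY EY0 EY2).
rewrite ge0_integralD//; last 2 first.
- by move=> u _; rewrite lee_fin sqr_ge0.
- by apply/measurable_EFinP/measurable_funX; exact: measurable_funB.
by rewrite integral_cst// [X in (_ * X + _)%E](_ : _ = 1%E) ?mule1//; exact: probability_setT.
Qed.

End experiment.

(** * The two bounds, for a set [K] containing the multiples of [psi] *)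

Section minimax_bounds.
Context d (X : measurableType d) (R : realType) (P : probability X R).
Context d' (Omega : measurableType d') (W : probability Omega R).
Variables (T K : set (L2 P)) (psi : L2 P) (gamma : L2 P -> R).
Variables (Delta : L2 P -> {RV W >-> R}) (B : set (L2 P)).
Hypotheses (subT : linear_subspace T) (closedT : L2_closed T).
Hypotheses (KT : K `<=` T) (Kpsi : forall a : R, K (a *: psi)).
Hypotheses (isoDelta : isonormal T Delta) (BS : B `<=` orth_in T K).

Local Notation S := (orth_in T K).
Local Notation full := (minimax T Delta (K `*` B)
  (fun h => h.1 + h.2) (fun h => ip psi h.1 + gamma h.2)).
Local Notation perp := (minimax S Delta B id gamma).

Lemma Tpsi : T psi.
Proof. by apply: KT; rewrite -[psi]scale1r. Qed.

Lemma orth_psi h : S h -> ip h psi = 0.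
Proof. by move=> [_ /(_ psi)]; apply; rewrite -[psi]scale1r. Qed.

Lemma orth_in_subspace : linear_subspace S.
Proof.
split; first by split; [exact: subT.1|move=> w _; rewrite ip0l].
move=> a f g [Tf f0] [Tg g0]; split; first exact: subT.2.
by move=> w Kw; rewrite ipDl ipZl f0// g0// mulr0 addr0.
Qed.

(** Continuity of the inner product: by [ip_young], if the distance from [f] to [g] is below
    [c = e / (ip w w + 1)], then [ip (f - g) w] is at most [e] in absolute value. *)
Lemma orth_in_closed : L2_closed S.
Proof.
move=> f fS; split.
  by apply: closedT => e /fS[g [Tg _]]; exists g.
move=> w Kw; apply/eqP; rewrite -normr_le0; apply/ler_addgt0Pr => e e0; rewrite add0r.
have h1 : 0 < ip w w + 1 by rewrite ltr_wpDl ?ip_ge0.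
pose c := e / (ip w w + 1).
have c0 : 0 < c by rewrite divr_gt0.
have [g [_ g0] fg] := fS _ c0.
have -> : ip f w = ip (f - g) w by rewrite ipDl ipNl g0// subr0.
have := ip_young (f - g) w c0; rewrite -L2norm_sqr => y.
have n2 : L2norm (f - g) ^+ 2 <= c ^+ 2.
  by rewrite ler_pXn2r// ?nnegrE ?fine_ge0 ?Lnorm_ge0 ?ltW.
have : 2 * c * `|ip (f - g) w| <= 2 * c * e.
  have -> : 2 * c * e = 2 * (c ^+ 2 * (ip w w + 1)).
    by rewrite /c; field; rewrite gt_eqF.
  apply: le_trans y _; have := sqr_ge0 c; have := ip_ge0 w; nra.
by rewrite ler_pM2l// mulr_gt0.
Qed.

Lemma measurable_restrict_orth : measurable_fun setT
  (fun z : sample_space T =>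
     (fun g => z (SigSub (mem_set (set_mem (valP g)).1))) : sample_space S).
Proof.
by apply: measurable_fun_cyl => g; exact: measurable_coord.
Qed.

Section upper.
Context d'' (U : measurableType d'') (Q : probability U R).
Variables (f : sample_space S * U -> R).
Hypothesis mf : measurable_fun setT f.

Definition add_core (zu : sample_space T * U) : R :=
  zu.1 (SigSub (mem_set Tpsi)) +
  f ((fun g => zu.1 (SigSub (mem_set (set_mem (valP g)).1))) : sample_space S, zu.2).

Lemma measurable_add_core : measurable_fun setT add_core.
Proof.
apply: measurable_funD.
  have mc : measurable_fun setT (fun z : sample_space T => z (SigSub (mem_set Tpsi))).
    exact: measurable_coord.
  exact: (measurableT_comp mc measurable_fst).
apply: (measurableT_comp mf); apply: measurable_fun_pair; last exact: measurable_snd.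
exact: (measurableT_comp measurable_restrict_orth measurable_fst).
Qed.

(** As [h2] is orthogonal to [psi], the observation at [psi] is [Delta psi + ip psi h1]; as [h1] is
    orthogonal to [S], it does not affect the restriction to [S]. The error is therefore that of [f]
    plus [Delta psi]. *)
Lemma risk_add_core h1 h2 : K h1 -> S h2 ->
  risk Delta Q add_core (h1 + h2) (ip psi h1 + gamma h2) =
  ((ip psi psi)%:E + risk Delta Q f h2 (gamma h2))%E.
Proof.
move=> Kh1 Sh2.
have mobs : measurable_fun setT (fun ou : Omega * U => f (obs Delta h2 ou.1, ou.2)).
  apply: (measurableT_comp mf); apply: measurable_fun_pair; last exact: measurable_snd.
  exact: (measurableT_comp (@measurable_obs _ _ _ P _ _ W S Delta h2) measurable_fst).
rewrite riskE; last exact: measurable_add_core.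
rewrite riskE//.
rewrite -(integral_loss_noise W Q (gamma h2) mobs (isonormal_sqint isoDelta Tpsi)
  (isonormal_mean isoDelta Tpsi)); last first.
  by under eq_integral do rewrite expr2; exact: (isonormal_cov isoDelta Tpsi Tpsi).
(* [Some g] indexes the noise on [S] and [None] the noise at [psi]. *)
pose u (i : option S) := if i is Some g then \val g else psi.
have Tu i : T (u i) by case: i => [g|]; [exact: (set_mem (valP g)).1|exact: Tpsi].
pose F' (yu : g_sigma_algebraType (@cyl R (option S)) * U) : R :=
  yu.1 None + f ((fun g => yu.1 (Some g) + ip h2 (\val g)) : sample_space S, yu.2).
have mF' : measurable_fun setT F'.
  apply: measurable_funD.
    exact: (measurableT_comp (@measurable_coord R _ None) measurable_fst).
  apply: (measurableT_comp mf); apply: measurable_fun_pair; last exact: measurable_snd.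
  have mt : measurable_fun setT (fun y : g_sigma_algebraType (@cyl R (option S)) =>
      (fun g => y (Some g) + ip h2 (\val g)) : sample_space S).
    apply: measurable_fun_cyl => g; apply: measurable_funD => //; exact: measurable_coord.
  exact: (measurableT_comp mt measurable_fst).
have g1 := isonormal_gaussian_process isoDelta (fun=> 1) Tu.
(* The same process with the noise at [psi] moved to a second factor: the coefficients [0] and [1]
   select the factor. The kernels agree because [psi] is orthogonal to [S]. *)
have g2 := gaussian_processD
  (isonormal_gaussian_process isoDelta
    (fun i : option S => if i is Some _ then 1 else 0) Tu)
  (isonormal_gaussian_process isoDelta
    (fun i : option S => if i is Some _ then 0 else 1) (fun=> Tpsi)).
transitivity (\int[W]_w loss Q F' (gamma h2) (fun i : option S => (1 * Delta (u i) w)%R))%E.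
  apply: eq_integral => w _; apply: eq_integral => x _; congr ((_ ^+ 2)%:E).
  rewrite /add_core /F' /obs /=.
  rewrite (_ : (fun g : S => 1 * Delta (\val g) w + ip h2 (\val g)) =
      (fun g : S => Delta (\val g) w + ip (h1 + h2) (\val g))); last first.
    apply/funext => g; rewrite mul1r ipDl (ipC h1) ((set_mem (valP g)).2 _ Kh1).
    by rewrite add0r.
  by rewrite ipDl (orth_psi Sh2) (ipC h1); ring.
rewrite (gaussian_process_integral g1 g2 _ (measurable_loss Q (gamma h2) mF'));
  [|move=> i j|by move=> y; exact: loss_ge0].
  apply: eq_integral => w _; apply: eq_integral => x _; congr ((_ ^+ 2)%:E).
  rewrite /F' /obs /=.
  rewrite (_ : (fun g : S => _ + ip h2 (\val g)) =
      (fun g : S => Delta (\val g) w.1 + ip h2 (\val g))); last first.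
    by apply/funext => g; rewrite mul1r mul0r addr0.
  by ring.
case: i => [g|]; case: j => [g'|] /=; rewrite ?(mul1r, mul0r, mulr0, addr0, add0r)//.
  by rewrite orth_psi//; exact: set_mem (valP g).
by rewrite ipC orth_psi//; exact: set_mem (valP g').
Qed.

End upper.

Lemma minimax_full_le : (full <= (ip psi psi)%:E + perp)%E.
Proof.
rewrite -leeBlDl//; apply: le_ereal_inf_tmp => _ [d'' [U [Q [f [mf ->]]]]].
rewrite leeBlDl//; apply: ge_ereal_inf.
exists (ereal_sup [set risk Delta Q (add_core f) (h.1 + h.2)
    (ip psi h.1 + gamma h.2) | h in K `*` B]).
  by exists d'', U, Q, (add_core f); split => //; exact: measurable_add_core.
apply: ge_ereal_sup => _ [[h1 h2] /= [Kh1 Bh2] <-].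
rewrite risk_add_core//; last exact: BS.
by apply: leeD => //; apply: ereal_sup_ubound; exists h2.
Qed.

Section lower.
Variable p : L2 P -> L2 P.
Hypotheses (Sp : forall g, S (p g)) (pP : forall g h, S h -> ip (g - p g) h = 0).
Variable b : R.

Local Notation V := (ip psi psi).

(* [b * Delta psi] is the prior of the coefficient of [psi]; [shrink] is the
   resulting coefficient of the observation at [psi] in the posterior mean of the
   core part of the target. *)
Definition shrink := (b * V) ^+ 2 / (1 + (b * V) ^+ 2).

Lemma shrinkE : shrink * (1 + (b * V) ^+ 2) = (b * V) ^+ 2.
Proof. by rewrite /shrink divfK// gt_eqF// ltr_pwDl ?sqr_ge0. Qed.

Lemma shrink_ge0 : 0 <= shrink.
Proof. by rewrite divr_ge0 ?addr_ge0 ?sqr_ge0. Qed.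

Lemma ip_projr g h : S h -> ip h (p g) = ip h g.
Proof.
move=> Sh; apply/eqP; rewrite eq_sym -subr_eq0 -ipNr -ipDr ipC.
by rewrite pP.
Qed.

Lemma ip_proj g g' : ip (p g) (p g') + ip (g - p g) (g' - p g') = ip g g'.
Proof.
rewrite ipDr (ipNr (g - p g)) (pP _ (Sp g')) oppr0 addr0.
by rewrite ipDl ipNl addrCA (ip_projr _ (Sp g)) subrr addr0.
Qed.

(* Extends an observation on [S] to one on [T] by an independent copy of the noise
   orthogonal to [S] and a core parameter drawn from the prior. *)
Definition rebuild (zo : sample_space S * (Omega * Omega)) : sample_space T :=
  fun g => zo.1 (SigSub (mem_set (Sp (\val g)))) +
    (Delta (\val g - p (\val g)) zo.2.1 + b * ip psi (\val g) * Delta psi zo.2.2).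

Lemma measurable_rebuild : measurable_fun setT rebuild.
Proof.
apply: measurable_fun_cyl => g; apply: measurable_funD.
  have mc : measurable_fun setT (fun z : sample_space S => z (SigSub (mem_set (Sp (\val g))))).
    exact: measurable_coord.
  exact: (measurableT_comp mc measurable_fst).
apply: measurable_funD.
  by apply: (measurableT_comp (measurable_funPT (Delta _))); exact: measurableT_comp.
apply: measurable_funM => //.
by apply: (measurableT_comp (measurable_funPT (Delta _))); exact: measurableT_comp.
Qed.

Context d'' (U : measurableType d'') (Q : probability U R).
Variables (f : sample_space T * U -> R).
Hypothesis mf : measurable_fun setT f.

(** The auxiliary variable consists of the regenerated noise, the prior draw and the randomization
    of [f]. The subtracted term is the posterior mean of the core part of the target given the
    rebuilt observation. *)
Definition strip_core (zou : sample_space S * ((Omega * Omega) * U)) : R :=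
  f (rebuild (zou.1, zou.2.1), zou.2.2) -
  shrink * rebuild (zou.1, zou.2.1) (SigSub (mem_set Tpsi)).

Lemma measurable_strip_core : measurable_fun setT strip_core.
Proof.
have mr : measurable_fun setT
    (fun zou : sample_space S * ((Omega * Omega) * U) => rebuild (zou.1, zou.2.1)).
  apply: (measurableT_comp measurable_rebuild); apply: measurable_fun_pair.
    exact: measurable_fst.
  exact: (measurableT_comp measurable_fst measurable_snd).
apply: measurable_funB.
  apply: (measurableT_comp mf); apply: measurable_fun_pair => //.
  exact: (measurableT_comp measurable_snd measurable_snd).
apply: measurable_funM => //.
have mc : measurable_fun setT (fun z : sample_space T => z (SigSub (mem_set Tpsi))).
  exact: measurable_coord.
exact: (measurableT_comp mc mr).
Qed.

(** The bound [r] is averaged over the prior draw. Under the prior, the observation and the core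
    part of the target are jointly distributed as the rebuilt observation and [shrink] times its
    value at [psi] minus an independent residual of variance [shrink * V]. *)
Lemma risk_strip_core h2 (r : \bar R) : S h2 ->
  (forall w, (risk Delta Q f ((b * Delta psi w) *: psi + h2)%R
    (ip psi ((b * Delta psi w) *: psi) + gamma h2)%R <= r)%E) ->
  ((shrink * V)%R%:E + risk Delta ((W \x W) \x Q) strip_core h2 (gamma h2) <= r)%E.
Proof.
move=> Sh2 riskr.
(* [Some g] indexes the observation at [g] without the shift by [h2], and [None] the core part of
   the target. *)
pose u (i : option T) := if i is Some g then \val g else psi.
have Tu i : T (u i) by case: i => [g|]; [exact: (set_mem (valP g))|exact: Tpsi].
have Tp i : T (p (u i)) by exact: (Sp _).1.
have Tr i : T (u i - p (u i)) by exact: linear_subspaceB.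
pose beta (i : option T) := b * ip psi (u i).
pose alpha (i : option T) : R := if i is Some _ then 1 else 0.
pose a (i : option T) : R := if i is Some _ then 1 else shrink.
pose delta (i : option T) : R := if i is Some _ then 0 else - Num.sqrt shrink.
pose F' (yu : g_sigma_algebraType (@cyl R (option T)) * U) : R :=
  f ((fun g => yu.1 (Some g) + ip h2 (\val g)) : sample_space T, yu.2) - yu.1 None.
have mF' : measurable_fun setT F'.
  apply: measurable_funB; last first.
    exact: (measurableT_comp (@measurable_coord R _ None) measurable_fst).
  apply: (measurableT_comp mf); apply: measurable_fun_pair; last exact: measurable_snd.
  have mt : measurable_fun setT (fun y : g_sigma_algebraType (@cyl R (option T)) =>
      (fun g => y (Some g) + ip h2 (\val g)) : sample_space T).
    apply: measurable_fun_cyl => g; apply: measurable_funD => //; exact: measurable_coord.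
  exact: (measurableT_comp mt measurable_fst).
(* The first factor carries the prior draw, the second the noise of the experiment. *)
have g1 := gaussian_processD
  (isonormal_gaussian_process isoDelta beta (fun=> Tpsi))
  (isonormal_gaussian_process isoDelta alpha Tu).
(* In order: the noise on [S], the noise orthogonal to [S], the prior draw, and the posterior
   residual, which [delta] places on the [None] coordinate only. *)
have g2 := gaussian_processD
  (gaussian_processD (isonormal_gaussian_process isoDelta a Tp)
    (gaussian_processD (isonormal_gaussian_process isoDelta a Tr)
       (isonormal_gaussian_process isoDelta (fun i => a i * beta i) (fun=> Tpsi))))
  (isonormal_gaussian_process isoDelta delta (fun=> Tpsi)).
pose G (w : Omega * Omega) := loss Q F' (gamma h2)
  (fun i : option T => beta i * Delta psi w.1 + alpha i * Delta (u i) w.2).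
have mG : measurable_fun setT G.
  exact: (measurableT_comp (measurable_loss Q (gamma h2) mF') (gaussian_process_measurable g1)).
have G0 w : (0 <= G w)%E by exact: loss_ge0.
have Gr w3 : (\int[W]_w1 G (w3, w1) <= r)%E.
  apply: le_trans (riskr w3); rewrite riskE; last exact: mf.
  rewrite le_eqVlt; apply/orP; left; apply/eqP.
  apply: eq_integral => w1 _; apply: eq_integral => x _; congr ((_ ^+ 2)%:E).
  rewrite /F' /obs /=.
  rewrite (_ : (fun g : T => beta (Some g) * _ + _ + ip h2 (\val g)) =
      (fun g : T => Delta (\val g) w1 + ip ((b * Delta psi w3) *: psi + h2) (\val g))); last first.
    by apply/funext => g; rewrite /beta/= ipDl ipZl; ring.
  by rewrite /beta/= ipZr; ring.
have r0 : (0 <= r)%E.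
  by apply: le_trans (Gr point); exact: integral_ge0.
(* For each prior draw the inner integral is a risk of [f], bounded by [r]; a probability average
   keeps the bound. *)
apply: (@le_trans _ _ (\int[W \x W]_w G w)%E); last first.
  rewrite fubini_tonelli1//; apply: (@le_trans _ _ (\int[W]_w r)%E).
    apply: ge0_le_integral => //; last by move=> w _; exact: Gr.
      by move=> w _; exact: integral_ge0.
    exact: (measurable_fun_fubini_tonelli_F (m2 := W) _ mG G0).
  by rewrite integral_cst// [X in (_ * X)%E](_ : _ = 1%E) ?mule1//; exact: probability_setT.
rewrite le_eqVlt; apply/orP; left; apply/eqP/esym.
rewrite (gaussian_process_integral g1 g2 _ (measurable_loss Q (gamma h2) mF'));
  [|move=> i j|by move=> y; exact: loss_ge0]; last first.
  (* The Gaussian conditioning formula: the covariances involving [None] match by the defining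
     relation [shrinkE]. *)
  have Kij : alpha i * alpha j * ip (u i) (u j) + beta i * beta j * V =
      a i * a j * (ip (u i) (u j) + beta i * beta j * V) + delta i * delta j * V.
    have sE : shrink * b ^+ 2 * V ^+ 2 = b ^+ 2 * V ^+ 2 - shrink.
      by have := shrinkE; rewrite exprMn => <-; ring.
    rewrite /alpha /a /delta /beta; case: i => [g|]; case: j => [g'|] /=.
    - ring.
    - by rewrite (ipC (\val g)); ring: sE.
    - by ring: sE.
    - by have e := sqr_sqrtr shrink_ge0; ring: e sE.
  by rewrite addrC Kij -ip_proj; ring.
(* [c] is [strip_core] with the observation and the regenerated noise as one variable, so that only
   the posterior residual is left as independent noise. *)
pose c (ou : (Omega * (Omega * Omega)) * U) : R :=
  strip_core (obs Delta h2 ou.1.1, (ou.1.2, ou.2)).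
have mc : measurable_fun setT c.
  apply: (measurableT_comp measurable_strip_core); apply: measurable_fun_pair.
    apply: (measurableT_comp (@measurable_obs _ _ _ P _ _ W S Delta h2)).
    exact: (measurableT_comp measurable_fst measurable_fst).
  apply: measurable_fun_pair; last exact: measurable_snd.
  exact: (measurableT_comp measurable_snd measurable_fst).
have W1 : (W setT < +oo)%E by rewrite probability_setT ltry.
have sY := sqintZ (Num.sqrt shrink) (isonormal_sqint isoDelta Tpsi).
have EY0 : (\int[W]_w (Num.sqrt shrink * Delta psi w)%:E = 0)%E.
  under eq_integral do rewrite EFinM.
  rewrite integralZl//; last exact: (sqint_integrable W1 (isonormal_sqint isoDelta Tpsi)).
  by rewrite (isonormal_mean isoDelta Tpsi) mule0.
have EY2 : (\int[W]_w ((Num.sqrt shrink * Delta psi w) ^+ 2)%:E = (shrink * V)%:E)%E.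
  under eq_integral do rewrite exprMn sqr_sqrtr ?shrink_ge0// EFinM.
  rewrite integralZl//; last exact: (isonormal_sqint isoDelta Tpsi).2.
  by under eq_integral do rewrite expr2; rewrite (isonormal_cov isoDelta Tpsi Tpsi).
transitivity ((shrink * V)%R%:E + \int[W \x (W \x W)]_o loss Q c (gamma h2) o)%E.
  rewrite -(integral_loss_noise _ Q (gamma h2) mc sY EY0 EY2).
  apply: eq_integral => w _; apply: eq_integral => x _; congr ((_ ^+ 2)%:E).
  rewrite /F' /c /strip_core /rebuild /obs /alpha /beta /a /delta /=.
  set z1 := (fun g : T => _); set z2 := (fun g : T => _).
  have -> : z1 = z2 by apply/funext => g; rewrite /z1 /z2 (ip_projr _ Sh2); ring.
  by rewrite (ip_projr _ Sh2) (orth_psi Sh2); ring.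
congr (_ + _)%E; rewrite riskE; last exact: measurable_strip_core.
(* Tonelli regroups the integrals so that the regenerated noise joins the auxiliary
   randomization. *)
pose WW : probability (Omega * Omega)%type R := (W \x W)%E.
etransitivity; first apply: (fubini_tonelli1 (m1 := W) (m2 := WW) (loss Q c (gamma h2))).
- exact: measurable_loss.
- by move=> w; exact: loss_ge0.
apply: eq_integral => w1 _; apply/esym.
apply: (fubini_tonelli1 (m1 := WW) (m2 := Q)
  (fun ou => ((strip_core (obs Delta h2 w1, ou) - gamma h2) ^+ 2)%:E)).
- apply: (measurableT_comp (measurable_sqloss (gamma h2) measurable_strip_core)).
  exact: measurable_pair1.
- by move=> ou; rewrite lee_fin sqr_ge0.
Qed.

End lower.

(** The supremum over [K] bounds the risk at every prior draw, since all multiples of [psi] lie in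
    [K]. A large [b] then brings [shrink b] close to [1]. *)
Lemma minimax_full_ge : (perp + (ip psi psi)%:E <= full)%E.
Proof.
have /choice[p pP] g : exists p, S p /\ forall h, S h -> ip (g - p) h = 0.
  exact: (projection g orth_in_subspace orth_in_closed).
have le b : (perp + (shrink b * ip psi psi)%:E <= full)%E.
  apply: le_ereal_inf_tmp => _ [d'' [U [Q [f [mf ->]]]]].
  set r := ereal_sup _.
  rewrite -leeBrDr//; apply: ge_ereal_inf.
  exists (ereal_sup [set risk Delta ((W \x W) \x Q)%E
      (strip_core (fun g => (pP g).1) b f) (id h) (gamma h) | h in B]).
    exists _, ((Omega * Omega) * U)%type, ((W \x W) \x Q)%E, (strip_core (fun g => (pP g).1) b f).
    by split => //; exact: measurable_strip_core.
  apply: ge_ereal_sup => _ [h2 Bh2 <-]; rewrite leeBrDr// addeC.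
  apply: risk_strip_core => //; [by move=> g h; exact: (pP g).2|exact: BS|move=> w].
  by apply: ereal_sup_ubound; exists ((b * Delta psi w) *: psi, h2) => //; split => /=.
apply/lee_addgt0Pr => e e0.
have [V0|V0] := eqVneq (ip psi psi) 0.
  have := le 0; rewrite V0 mulr0 => /le_trans; apply.
  by rewrite leeDl// lee_fin ltW.
have Vgt0 : 0 < ip psi psi by rewrite lt_neqAle eq_sym V0 ip_ge0.
(* With [V] for [ip psi psi], this makes [(b * V) ^+ 2 = V / e], so that
   [V - shrink b * V = e V / (e + V)] is less than [e]. *)
pose b := Num.sqrt (ip psi psi / e) / ip psi psi.
have sb : ip psi psi <= shrink b * ip psi psi + e.
  rewrite /shrink /b divfK// sqr_sqrtr ?divr_ge0 ?ltW//.
  move: (ip psi psi) Vgt0 => v v0.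
  have -> : v / e / (1 + v / e) * v + e = v + e ^+ 2 / (e + v).
    by field; rewrite !gt_eqF// addr_gt0.
  by rewrite ltrDl divr_gt0 ?exprn_gt0 ?addr_gt0.
apply: (@le_trans _ _ (perp + (shrink b * ip psi psi)%:E + e%:E)%E).
  by rewrite -addeA leeD2l// -EFinD lee_fin.
by rewrite leeD2r.
Qed.

End minimax_bounds.

Unset Implicit Arguments.

Theorem theorem7
    (R : realType) (d : measure_display) (X : measurableType d)
    (model : set (probability X R)) (P : probability X R) (modelP : model P)
    (T : set (L2 P)) (subT : linear_subspace T) (meanT : mean_zero T)
    (Psi : probability X R -> R) (gamma : L2 P -> R)
    (assumption1 : path_realization model T)
    (dPsi : directional_derivative model T Psi gamma)
    (assumption2 : core T gamma = additivity_space T gamma)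
    (psi : L2 P) (rieszpsi : riesz_representer gamma (core T gamma) psi)
    (d' : measure_display) (Omega : measurableType d') (W : probability Omega R)
    (Delta : L2 P -> {RV W >-> R}) (isoDelta : isonormal T Delta) :
  (forall B : set (L2 P), B !=set0 -> B `<=` orth_in T (core T gamma) ->
     minimax_full T gamma psi Delta B
     = ((L2norm psi ^+ 2)%:E + minimax_perp T gamma Delta B)%E) /\
  minimax_full T gamma psi Delta [set 0] = (L2norm psi ^+ 2)%:E.
Proof.
have closedT : L2_closed T := assumption1.1.
have KT : core T gamma `<=` T by move=> w [[]].
have gamma0 : gamma 0 = 0.
  by have := dPsi.1 0 0 (lexx 0) subT.1; rewrite scale0r mul0r.
have N0 : Ngamma T gamma 0 by split; [exact: subT.1|rewrite oppr0 gamma0 addr0].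
have Kpsi (a : R) : core T gamma (a *: psi).
  have [[Tpsi _] addpsi] := rieszpsi.1.
  (* Additivity along the core at [v = 0] gives homogeneity for negative [c] as well. *)
  have gZ (c : R) : gamma (c *: psi) = c * gamma psi.
    by have := addpsi 0 c N0; rewrite gamma0 !add0r.
  split; first split.
  - exact: linear_subspaceZ.
  - by rewrite -scaleNr !gZ mulNr subrr.
  - by move=> v c Nv; rewrite scalerA addpsi// gZ mulrA.
have main (B : set (L2 P)) : B `<=` orth_in T (core T gamma) ->
    minimax_full T gamma psi Delta B =
    ((L2norm psi ^+ 2)%:E + minimax_perp T gamma Delta B)%E.
  move=> BS; rewrite L2norm_sqr; apply/eqP; rewrite eq_le; apply/andP; split.
    exact: minimax_full_le.
  by rewrite addeC; exact: minimax_full_ge.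
split=> [B _|]; first exact: main.
have S0 : orth_in T (core T gamma) 0.
  by split; [exact: subT.1|move=> w _; rewrite ip0l].
rewrite main; last by move=> _ ->.
suff -> : minimax_perp T gamma Delta [set 0] = 0%E by rewrite adde0.
apply/eqP; rewrite eq_le; apply/andP; split.
  apply: ge_ereal_inf.
  (* The constant statistic [0] is exact at the only parameter, where [gamma 0 = 0]; [W] serves as a
     dummy auxiliary law. *)
  exists (ereal_sup [set risk (S := orth_in T (core T gamma)) Delta W
    (fun=> 0%R) (id h) (gamma h) | h in [set 0]]).
    by exists d', Omega, W, (fun=> 0%R); split => //.
  apply: ge_ereal_sup => _ [_ -> <-].
  rewrite /risk expectation.unlock gamma0 integral0_eq// => w _.
  by rewrite subrr expr0n.
apply: le_ereal_inf_tmp => _ [d'' [U [Q [f [_ ->]]]]].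
apply: (@le_trans _ _ (risk Delta Q f 0 (gamma 0))).
  by rewrite /risk expectation.unlock; apply: integral_ge0 => w _; rewrite lee_fin sqr_ge0.
by apply: ereal_sup_ubound; exists 0.
Qed.
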